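(* Let $\mathbb{F}$ be a field and let $R(s)\in\mathbb{F}(s)^{m\times n}$ be a rational matrix (respectively, let $R(s)\in\mathbb{F}[s]^{m\times n}$ be a polynomial matrix) with $\operatorname{rank}(R(s))=r\ge1$. Let $\mathbf{u}=(u_1,\dots,u_{m-r})$ be its row minimal indices. Let $z,x$ be integers such that $0\le x\le\min\{z,n-r\}$ and let $\mathbf{v}=(v_1,\dots,v_{m+z-r-x})$ be a partition. There exists a rational matrix $\widetilde W(s)\in\mathbb{F}(s)^{z\times n}$ (respectively, a polynomial matrix $\widetilde W(s)\in\mathbb{F}[s]^{z\times n}$) such that $\operatorname{rank}\begin{bmatrix}R(s)\\\widetilde W(s)\end{bmatrix}=r+x$ and $\begin{bmatrix}R(s)\\\widetilde W(s)\end{bmatrix}$ has $\mathbf{v}$ as row minimal indices if and only if $$\sum_{i=1}^{m+z-r-x}v_i-\sum_{i=1}^{m-r}u_i\ge0\qquad\text{and}\qquad \mathbf{v}\prec'(\mathbf{u},\hat{\tilde{\mathbf{b}}}''),$$ where $\hat{\tilde{\mathbf{b}}}''=(\hat{\tilde b}''_1,\dots,\hat{\tilde b}''_{z-x})$ is defined by $$\sum_{i=1}^{j}\hat{\tilde b}''_i=\sum_{i=1}^{m+z-r-x}v_i-\sum_{i=1}^{m-r}u_i,\quad 1\le j\le z-x$$ (i.e., $\hat{\tilde b}''_1=\sum_{i=1}^{m+z-r-x}v_i-\sum_{i=1}^{m-r}u_i$ and $\hat{\tilde b}''_i=0$ for $2\le i\le z-x$).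
   Context: Structural data. $\mathbb{F}(s)$ is the field of rational functions over $\mathbb{F}$. The rank of a matrix is its rank over $\mathbb{F}(s)$. For a subspace of $\mathbb{F}(s)^{k\times 1}$, a minimal basis is a basis of polynomial vectors whose sum of degrees is least among all polynomial bases; the degrees of its vectors (independent of the choice) are the minimal indices of the subspace. The row minimal indices of $R(s)\in\mathbb{F}(s)^{m\times n}$ are the minimal indices of $\{y\in\mathbb{F}(s)^{m\times1}:y^TR=0\}$, always listed in decreasing order; there are $m-r$ of them if $R$ has rank $r$. Conventions. ''Decreasing'' is meant in the weak sense. A partition is a decreasing sequence of nonnegative integers (possibly empty). A decreasing sequence $a_1\ge\dots\ge a_k$ is extended by $a_i=+\infty$ for $i<1$ and $a_i=-\infty$ for $i>k$. A sum whose upper limit is smaller than its lower limit is $0$; a condition over an empty index range is trivially satisfied. Generalized majorization. Let $\mathbf d=(d_1,\dots,d_k)$, $\mathbf a=(a_1,\dots,a_t)$, $\mathbf g=(g_1,\dots,g_{k+t})$ be sequences of integers ($\mathbf d$, $\mathbf g$ decreasing). Then $\mathbf g\prec'(\mathbf d,\mathbf a)$ means: (i) $d_i\ge g_{i+t}$ for $1\le i\le k$; (ii) $\sum_{i=1}^{h_j}g_i-\sum_{i=1}^{h_j-j}d_i\le\sum_{i=1}^{j}a_i$ for $1\le j\le t$, where $h_j=\min\{i: d_{i-j+1}<g_i\}$ (with $d_{k+1}=-\infty$); (iii) $\sum_{i=1}^{k+t}g_i=\sum_{i=1}^{k}d_i+\sum_{i=1}^{t}a_i$. If $t=0$ this means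 $\mathbf g=\mathbf d$. *)

(* Defs.v *)
From mathcomp Require Import all_boot all_order all_algebra.

Set Implicit Arguments.
Unset Strict Implicit.
Unset Printing Implicit Defensive.

Import Order.TTheory GRing.Theory Num.Theory.
Local Open Scope ring_scope.

Notation ratfun F := {fraction {poly F}}.

Definition ratmx (F : fieldType) (m n : nat) (A : 'M[{poly F}]_(m, n)) :
  'M[ratfun F]_(m, n) := map_mx (@tofrac {poly F}) A.

(* The zero vector gets degree 0; it never occurs in a basis. *)
Definition vec_degree (F : fieldType) (k : nat) (y : 'cV[{poly F}]_k) : nat :=
  \max_(i < k) (size (y i 0%R)).-1.

Definition poly_basis (F : fieldType) (k : nat)
    (U : {vspace 'cV[ratfun F]_k}) (X : seq 'cV[{poly F}]_k) : bool :=
  basis_of U [seq ratmx y | y <- X].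

Definition minimal_basis (F : fieldType) (k : nat)
    (U : {vspace 'cV[ratfun F]_k}) (X : seq 'cV[{poly F}]_k) : Prop :=
  poly_basis U X /\
  forall Y, poly_basis U Y ->
    (\sum_(y <- X) vec_degree y <= \sum_(y <- Y) vec_degree y)%N.

Definition minimal_indices (F : fieldType) (k : nat)
    (U : {vspace 'cV[ratfun F]_k}) (u : seq nat) : Prop :=
  sorted geq u /\
  exists2 X, minimal_basis U X & perm_eq u [seq vec_degree y | y <- X].

Definition left_null (F : fieldType) (m n : nat) (R : 'M[ratfun F]_(m, n)) :
  {vspace 'cV[ratfun F]_m} := lker (linfun (mulmxr R \o trmx)).

Lemma mem_left_null (F : fieldType) (m n : nat) (R : 'M[ratfun F]_(m, n)) y :
  (y \in left_null R) = (y^T *m R == 0).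
Proof. by rewrite memv_ker lfunE. Qed.

Definition row_minimal_indices (F : fieldType) (m n : nat)
    (R : 'M[ratfun F]_(m, n)) (u : seq nat) : Prop :=
  minimal_indices (left_null R) u.

(* Sequences are stored from index 0, so d_i is d`_i.-1 and d_(i-j+1) is
   d`_(i - j). The condition d_(i-j+1) < g_i is read with d_l = +oo for l < 1
   (hence j <= i) and d_l = -oo for l > size d. For 1 <= j <= t the minimum is
   attained in the searched range, at some j <= i <= size d + j; as the range
   starts at 0, the position returned by find is i itself. *)
Definition maj_h (d g : seq int) (j : nat) : nat :=
  find (fun i => (j <= i)%N && ((size d <= i - j)%N || (d`_(i - j) < g`_i.-1)))
    (iota 0 (size g).+1).

(* gen_majorized g d a is g <' (d, a), with size d = k and size a = t. *)
Definition gen_majorized (g d a : seq int) : Prop :=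
  if size a is 0 then g = d else
  [/\ size g = (size d + size a)%N,
      forall i, (i < size d)%N -> g`_(i + size a) <= d`_i,
      forall j, (1 <= j <= size a)%N ->
        \sum_(0 <= i < maj_h d g j) g`_i - \sum_(0 <= i < maj_h d g j - j) d`_i
          <= \sum_(0 <= i < j) a`_i
    & \sum_(e <- g) e = \sum_(e <- d) e + \sum_(e <- a) e].

Definition zseq (u : seq nat) : seq int := [seq Posz e | e <- u].

Definition index_gap (v u : seq nat) : int :=
  \sum_(e <- zseq v) e - \sum_(e <- zseq u) e.

(* The sequence of length l all of whose nonempty partial sums equal c. *)
Definition const_psum (c : int) (l : nat) : seq int :=
  mkseq (fun i => if i == 0%N then c else 0) l.

(* Main.v *)
From HB Require Import structures.
Require Import Defs.
From mathcomp Require Import all_boot all_order all_fingroup all_algebra.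
From mathcomp Require Import zify.
From Stdlib Require Classical_Prop.
Import Order.TTheory GRing.Theory Num.Theory.
Local Open Scope ring_scope.

Set Implicit Arguments.
Unset Strict Implicit.
Unset Printing Implicit Defensive.

(** Let U be the left null space of R and V that of the completed matrix
[R; W]. The vectors of V with zero last z coordinates form a copy of U, and
dim V = dim U + t with t = z - x. Minimal bases are handled through the
exchange property [reduced]: a polynomial vector is never of smaller degree
than a basis vector on which it has a nonzero coordinate. It is equivalent to
minimality of the degree sum ([sum_min_reduced], [reduced_sum_min]), and it
yields the predictable degree property and polynomial coordinates for
polynomial vectors ([reduced_combination]).

The central inequality ([degree_sum_le]) says that cutting a subspace by
coordinates cannot increase the sum of its minimal indices. For large D, the
dimension over F of the polynomial vectors of degree at most D in a subspace
with minimal indices g_1, ..., g_p is the sum of the D + 1 - g_j, and each of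
the e coordinates that are set to zero costs at most D + 1 linear conditions.

Necessity. If u_l < v_i whenever i <= h and l > q, then by the exchange
property the rows of degree u_l with l > q of the minimal basis of U lie in
the span of the rows of degree v_i with i > h of that of V. Cutting this span
by the last z coordinates gives a subspace of U of dimension at least that of
these rows, so the central inequality gives
    sum of u_l over l > q  <=  sum of v_i over i > h    ([tail_sum_le]).
With (h, q) = (0, 0) this is the nonnegativity of the gap c, with
(h, q) = (h_j, h_j - j) it is condition (ii) of the majorization, and the
comparison of the numbers of rows gives condition (i) ([tail_size_le]).

Sufficiency. The first t rows of W are polynomial combinations Y R of the rows
of R, and the other x rows are polynomial and independent modulo R, which does
not affect the null space. Adding a single row y R adds the generator (-y, 1)
to the null space. By a suitable choice of y ([null_indices_extension]), some
indices of U may be lowered by amounts e_i, the new index being c + sum e_i,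
provided that the lowered indices do not become smaller than the new one;
c > 0 requires a constant direction independent of the leading coefficients of
the basis of U, which exists because the rank of R is positive. In the
construction the degrees are bounded from above, and the central inequality
shows that their sum cannot be smaller, so that the bounds are attained.

The conditions (i) and (ii) allow to match all but t of the v_i greedily with
the u_l in such a way that each matched v_i is at most its partner and that,
from any position on, the v's have at least the sum of the partners
([matching_ex]). The t unmatched values are then created one after the other,
from the largest one; the first step uses up the whole gap c, the later ones
have gap zero ([null_indices_chain]). *)

(** * Degrees of polynomial rows *)

Section PolynomialRows.

Variable F : fieldType.
Local Notation P := {poly F}.
Local Notation K := (ratfun F).

(** This is [vec_degree] of the transpose: basis vectors are kept as the rows of
a matrix, so that coordinates with respect to a basis are matrix products. *)
Definition rdeg m (y : 'rV[P]_m) : nat := \max_(j < m) (size (y 0%R j)).-1.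

Lemma rdeg_leP m (y : 'rV[P]_m) D :
  reflect (forall j, (size (y 0 j)%R <= D.+1)%N) (rdeg y <= D)%N.
Proof.
by apply: (iffP (bigmax_leqP _ _ _)) => [h j|h j _]; move: (h j); lia.
Qed.

Lemma size_row_rdeg m (y : 'rV[P]_m) j : (size (y 0 j)%R <= (rdeg y).+1)%N.
Proof. by move: j; apply/rdeg_leP. Qed.

Lemma rdeg_row_mx m1 m2 (y : 'rV[P]_m1) (w : 'rV[P]_m2) :
  rdeg (row_mx y w) = maxn (rdeg y) (rdeg w).
Proof.
rewrite /rdeg big_split_ord /=; congr maxn.
  by apply: eq_bigr => j _; rewrite row_mxEl.
by apply: eq_bigr => j _; rewrite row_mxEr.
Qed.

Lemma rdeg0 m : rdeg (0 : 'rV[P]_m) = 0%N.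
Proof. by apply/eqP; rewrite -leqn0; apply/rdeg_leP => j; rewrite mxE size_poly0. Qed.

Lemma rdeg_lsubmx m1 m2 (y : 'rV[P]_(m1 + m2)) : (rdeg (lsubmx y) <= rdeg y)%N.
Proof. by rewrite -{2}[y]hsubmxK rdeg_row_mx leq_maxl. Qed.

Lemma ratmx_inj m n : injective (@ratmx F m n).
Proof.
move=> A B /matrixP AB; apply/matrixP => i j; apply/eqP.
by rewrite -tofrac_eq; move: (AB i j); rewrite !mxE => ->.
Qed.

Lemma ratmxM m n p (A : 'M[P]_(m, n)) (B : 'M[P]_(n, p)) :
  ratmx (A *m B) = ratmx A *m ratmx B.
Proof. exact: map_mxM. Qed.

Lemma fraction_repr (a : K) : exists p q : P, q != 0 /\ a * tofrac q = tofrac p.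
Proof.
elim/quotW: a => x; exists (frac x).1, (frac x).2; split; first exact: denom_ratioP.
apply/eqP; rewrite -[_ * _]/(FracField.mul _ _) !piE.
rewrite /equivf /FracField.mulf !numden_Ratio ?oner_eq0 ?mulr1 ?mulf_neq0 ?oner_neq0 ?denom_ratioP //.
by rewrite mulrC.
Qed.

End PolynomialRows.

(** * Reduced matrices and predictable degrees *)

Section Reduced.

Variable F : fieldType.
Local Notation P := {poly F}.
Local Notation K := (ratfun F).

Lemma common_denominator m n (A : 'M[K]_(m, n)) :
  exists (q : P) (B : 'M[P]_(m, n)), q != 0 /\ tofrac q *: A = ratmx B.
Proof.
have [f fP] := fin_all_exists (fun ij : 'I_m * 'I_n =>
  let: ex_intro p (ex_intro q pq) := fraction_repr (A ij.1 ij.2) in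
  ex_intro (fun u : P * P => u.2 != 0 /\ A ij.1 ij.2 * tofrac u.2 = tofrac u.1)
    (p, q) pq).
exists (\prod_ij (f ij).2),
  (\matrix_(i, j) ((f (i, j)).1 * \prod_(ij | ij != (i, j)) (f ij).2)); split.
  by apply/prodf_neq0 => ij _; case: (fP ij).
apply/matrixP => i j; rewrite !mxE (bigD1 (i, j)) //= !tofracM.
by have [_ /= <-] := fP (i, j); rewrite mulrC mulrA.
Qed.

Lemma rdeg_lt m (y : 'rV[P]_m) D :
  y != 0 -> (forall j, size (y 0 j)%R <= D)%N -> (rdeg y < D)%N.
Proof.
case: D => [|D] y0 h; last by rewrite ltnS; apply/rdeg_leP.
case/eqP: y0; apply/rowP => j; rewrite mxE.
by apply/eqP; rewrite -size_poly_leq0.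
Qed.

Definition row_deg k m (N : 'M[P]_(k, m)) (i : 'I_k) := rdeg (row i N).

Lemma size_row_deg k m (N : 'M[P]_(k, m)) i j :
  (size (N i j)%R <= (row_deg N i).+1)%N.
Proof. by have := size_row_rdeg (row i N) j; rewrite mxE. Qed.

(** The exchange property that characterizes the matrices whose rows form a
minimal basis of their row space. *)
Definition reduced k m (N : 'M[P]_(k, m)) : Prop :=
  row_free (ratmx N) /\
  forall (y : 'rV[P]_m) (a : 'rV[K]_k), ratmx y = a *m ratmx N ->
    forall i, a 0 i != 0 -> (row_deg N i <= rdeg y)%N.

(** For [d := row_deg N] this is the matrix of the leading coefficients of the
rows; other choices of [d] serve rows whose degree is only bounded. *)
Definition coef_rows k m (d : 'I_k -> nat) (N : 'M[P]_(k, m)) : 'M[F]_(k, m) :=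
  \matrix_(i, j) (N i j)`_(d i).

Lemma ratmx_eq0 k m (N : 'M[P]_(k, m)) : (ratmx N == 0) = (N == 0).
Proof.
apply/eqP/eqP => [h|->]; last by rewrite /ratmx map_mx0.
by apply: ratmx_inj; rewrite h /ratmx map_mx0.
Qed.

Lemma row_free_mul_eq0 k m (N : 'M[P]_(k, m)) (b : 'rV[P]_k) :
  row_free (ratmx N) -> (b *m N == 0) = (b == 0).
Proof.
move=> fN; rewrite -(ratmx_eq0 (b *m N)) ratmxM -(ratmx_eq0 b).
by rewrite -(inj_eq (row_free_inj fN)) mul0mx.
Qed.

(** A linear relation between the leading coefficient rows, homogenized by
powers of the variable, gives a vector of smaller degree than the largest row
which it involves; this contradicts the exchange property. *)
Lemma reduced_lead_free k m (N : 'M[P]_(k, m)) :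
  reduced N -> row_free (coef_rows (row_deg N) N).
Proof.
case=> fN minN; apply: inj_row_free => c c0.
apply/eqP/negPn/negP => cn0; have /rV0Pn[i0 ci0] := cn0.
case: (@arg_maxnP _ i0 (fun i => c 0 i != 0) (row_deg N) ci0) => i ci max_i.
set D := row_deg N i in max_i *.
(* The relation homogenized to degree D: the terms of degree D cancel. *)
pose b : 'rV[P]_k := \row_j (c 0 j *: 'X^(D - row_deg N j)).
have bi : b 0 i != 0 by rewrite mxE scaler_eq0 negb_or ci monic_neq0 ?monicXn.
have y0 : b *m N != 0.
  rewrite row_free_mul_eq0 //; apply: contraNneq bi => ->; by rewrite mxE.
have : (rdeg (b *m N) < D)%N.
  apply: rdeg_lt => // l; apply/leq_sizeP => n Dn; rewrite mxE coef_sum.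
  transitivity (\sum_j (c 0 j * (N j l)`_(n - D + row_deg N j))).
    apply: eq_bigr => j _; rewrite mxE -scalerAl coefZ coefXnM.
    have [->|cj] := eqVneq (c 0 j) 0; first by rewrite !mul0r.
    have := max_i _ cj; rewrite ltnNge; case: leqP => [_|]; last lia.
    by move=> le_d; congr (_ * _`_ _); lia.
  have [->|nD] := eqVneq n D.
    move/rowP: c0 => /(_ l); rewrite !mxE => c0; rewrite -[RHS]c0.
    by apply: eq_bigr => j _; rewrite !mxE subnn.
  apply: big1 => j _; rewrite nth_default ?mulr0 //.
  by apply: leq_trans (size_row_deg N j l) _; move: nD Dn; clearbody D; lia.
have /(_ i) := minN (b *m N) _ (ratmxM _ _).
rewrite mxE tofrac_eq0 => /(_ bi); rewrite -/D; lia.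
Qed.

Lemma coefM_top (p q : P) a b : (size p <= a.+1)%N -> (size q <= b.+1)%N ->
  (p * q)`_(a + b) = p`_a * q`_b.
Proof.
move=> sp sq; have la : (a < (a + b).+1)%N by lia.
rewrite coefM (bigD1 (Ordinal la)) //= addKn big1 ?addr0 // => i.
rewrite -val_eqE /= => ia; have [lt_ia|le_ai] := ltnP i a.
  by rewrite [q`__]nth_default ?mulr0 //; apply: leq_trans sq _; lia.
by rewrite nth_default ?mul0r //; apply: leq_trans sp _; move: ia le_ai; lia.
Qed.

(** The top coefficient of [b *m N] is a combination of the rows of [coef_rows]
whose coefficients are leading coefficients of entries of [b], so that it
cannot vanish. *)
Lemma predictable_degree k m (N : 'M[P]_(k, m)) d (b : 'rV[P]_k) D :
    (forall i j, size (N i j)%R <= (d i).+1)%N -> row_free (coef_rows d N) ->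
    (forall j, size ((b *m N) 0 j)%R <= D)%N ->
  forall i, b 0 i != 0 -> (size (b 0 i)%R + d i <= D)%N.
Proof.
move=> dN fN bD i1 bi1; rewrite leqNgt; apply/negP => i1D.
pose f j := (size (b 0 j)%R + d j)%N.
case: (@arg_maxnP _ i1 (fun j => b 0 j != 0) f bi1) => i bi max_i.
have le_D : (D < f i)%N by apply: leq_trans i1D _; exact: max_i.
pose t := (f i).-1.
pose c : 'rV[F]_k := \row_j (b 0 j)`_(t - d j).
have c0 : c *m coef_rows d N = 0.
  apply/rowP => l; rewrite !mxE.
  transitivity (((b *m N) 0 l)`_t); last first.
    by rewrite nth_default //; apply: leq_trans (bD l) _; rewrite /t; lia.
  rewrite mxE coef_sum; apply: eq_bigr => j _; rewrite !mxE.
  have [->|bj] := eqVneq (b 0 j) 0; first by rewrite mul0r !coef0 mul0r.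
  have le_j : (size (b 0 j)%R + d j <= f i)%N := max_i _ bj.
  have sj : (0 < size (b 0 j)%R)%N by rewrite size_poly_gt0.
  have tE : t = (t - d j + d j)%N by rewrite /t; lia.
  have sb : (size (b 0 j)%R <= (t - d j).+1)%N by rewrite /t; lia.
  by rewrite [in RHS]tE (coefM_top sb).
have /rowP/(_ i) : c = 0 by apply: (row_free_inj fN); rewrite c0 mul0mx.
rewrite !mxE /t /f => /eqP; have -> : ((size (b 0%R i) + d i).-1 - d i =
  (size (b 0%R i)).-1)%N by lia.
by rewrite -lead_coefE lead_coef_eq0 (negPf bi).
Qed.

(** Write the coordinates as p / q and divide p by q: if the remainders r do not
all vanish, then (r / q) N is a polynomial vector of smaller degree than the
largest row with a nonzero remainder, against the exchange property. *)
Lemma reduced_saturated k m (N : 'M[P]_(k, m)) (y : 'rV[P]_m) (a : 'rV[K]_k) :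
  reduced N -> ratmx y = a *m ratmx N -> exists b, a = ratmx b.
Proof.
move=> redN ya; have [fN minN] := redN.
have [q [p [q0 qa]]] := common_denominator a.
have q0' : tofrac q != 0 by rewrite tofrac_eq0.
pose b : 'rV[P]_k := \row_i (p 0 i %/ q)%R; pose r : 'rV[P]_k := \row_i (p 0 i %% q)%R.
have pE : p = q *: b + r.
  by apply/rowP => i; rewrite !mxE mulrC -divp_eq.
have raE : ratmx r = tofrac q *: (a - ratmx b).
  rewrite scalerBr qa pE; apply/rowP => i; rewrite !mxE tofracD tofracM.
  by rewrite addrAC subrr add0r.
have yE : ratmx (y - b *m N) = (a - ratmx b) *m ratmx N.
  by rewrite mulmxBl -ya -ratmxM; apply/rowP => i; rewrite !mxE tofracB.
exists b; apply/eqP; rewrite -subr_eq0; apply/negP => /negP ab0.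
have /rV0Pn[i0 ri0] := ab0.
case: (@arg_maxnP _ i0 (fun i => (a - ratmx b) 0 i != 0) (row_deg N) ri0) => i ri max_i.
have := minN _ _ yE i ri; apply/negP; rewrite -ltnNge.
have y0 : y - b *m N != 0.
  by rewrite -ratmx_eq0 yE -(mul0mx _ (ratmx N)) (inj_eq (row_free_inj fN)).
apply: rdeg_lt => // l.
have [->|yl0] := eqVneq ((y - b *m N) 0 l) 0; first by rewrite size_poly0.
have : q *: (y - b *m N) = r *m N.
  apply: ratmx_inj; rewrite ratmxM raE -scalemxAl -yE.
  by apply/rowP => j; rewrite !mxE tofracM.
move=> /rowP/(_ l); rewrite mxE => qy.
have cancel_size s x e : (0 < s)%N -> ((s + x).-1 <= s + e - 1)%N -> (x <= e)%N.
  by clear; lia.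
apply: (cancel_size (size q)); first by rewrite size_poly_gt0.
rewrite -size_mul // qy mxE; apply: (leq_trans (size_sum _ _ _)); apply/bigmax_leqP => j _.
have [->|rj] := eqVneq (r 0 j) 0; first by rewrite mul0r size_poly0.
apply: leq_trans (size_polyMleq _ _) _.
have : (a - ratmx b) 0 j != 0.
  apply: contraNneq rj => rj; rewrite -tofrac_eq0.
  by move/rowP: raE => /(_ j); rewrite mxE => ->; rewrite mxE rj mulr0.
move/max_i => le_j.
have bound s1 s2 s3 d1 d2 : (s1 < s3)%N -> (s2 <= d1.+1)%N -> (d1 <= d2)%N ->
  ((s1 + s2).-1 <= s3 + d2 - 1)%N by clear; lia.
by apply: bound (size_row_deg N j l) le_j; rewrite mxE ltn_modp.
Qed.

Lemma reduced_combination k m (N : 'M[P]_(k, m)) (y : 'rV[P]_m) :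
    reduced N -> (ratmx y <= ratmx N)%MS ->
  exists2 b : 'rV[P]_k, y = b *m N &
    forall i, b 0 i != 0 -> (size (b 0 i)%R + row_deg N i <= (rdeg y).+1)%N.
Proof.
move=> redN /submxP[a ya]; have [b ab] := reduced_saturated redN ya.
have yb : y = b *m N by apply: ratmx_inj; rewrite ya ab ratmxM.
exists b => //; apply: (@predictable_degree _ _ N).
- exact: size_row_deg.
- exact: reduced_lead_free.
by move=> j; rewrite -yb size_row_rdeg.
Qed.

End Reduced.

(** * Minimal bases as reduced matrices *)

Section Minimality.

Variable F : fieldType.
Local Notation P := {poly F}.
Local Notation K := (ratfun F).

Lemma ratmx_row k m (N : 'M[P]_(k, m)) i : ratmx (row i N) = row i (ratmx N).
Proof. exact: map_row. Qed.

(** A nonzero determinant has a nonzero term in its Leibniz expansion. *)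
Lemma perm_of_unitmx n (A : 'M[K]_n) :
  A \in unitmx ->
  exists s : 'S_n, forall i, A i (s i) != 0.
Proof.
rewrite unitmxE unitfE => dA.
have [/existsP[s /forallP hs]|/existsPn h] :=
  boolP [exists s : 'S_n, [forall i, A i (s i) != 0]]; first by exists s.
case/eqP: dA; rewrite /determinant big1 // => s _.
have /forallPn[i /negPn/eqP Ai] := h s.
by rewrite (bigD1 i) //= Ai mul0r mulr0.
Qed.

(** The coordinates of Y with respect to N contain an invertible square
submatrix; a nonzero term of its determinant pairs the rows of Y with distinct
rows of N, and the exchange property compares the degrees in each pair. *)
Lemma reduced_dominated k k' m (N : 'M[P]_(k, m)) (Y : 'M[P]_(k', m)) :
    reduced N -> row_free (ratmx Y) -> (ratmx Y <= ratmx N)%MS ->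
  exists2 s : 'I_k' -> 'I_k, injective s &
    forall j, (row_deg N (s j) <= row_deg Y j)%N.
Proof.
move=> [_ minN] fY /submxP[A YA].
have fA : row_full A^T.
  rewrite -col_leq_rank mxrank_tr; move: fY; rewrite -row_leq_rank YA => h.
  exact: leq_trans h (mxrankM_maxl _ _).
have [s sA] := perm_of_unitmx (fullrowsub_unit fA).
exists (fun j => fullrankfun fA ((s^-1)%g j)).
  by move=> i j /fullrankfun_inj/perm_inj.
move=> j; apply: (minN (row j Y) (row j A)).
  by rewrite ratmx_row YA row_mul.
by have := sA ((s^-1)%g j); rewrite permKV !mxE.
Qed.

Lemma reduced_sum_min k m (N Y : 'M[P]_(k, m)) :
    reduced N -> row_free (ratmx Y) -> (ratmx Y <= ratmx N)%MS ->
  (\sum_i row_deg N i <= \sum_i row_deg Y i)%N.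
Proof.
move=> rN fY YN; have [s inj_s sY] := reduced_dominated rN fY YN.
by rewrite (reindex_inj inj_s) /=; apply: leq_sum.
Qed.

(** Replacing a row of N by a vector with a nonzero coordinate on it gives another
basis, so minimality of the degree sum forbids a drop of the degree. *)
Lemma sum_min_reduced k m (N : 'M[P]_(k, m)) :
    row_free (ratmx N) ->
    (forall Y : 'M[P]_(k, m), row_free (ratmx Y) -> (ratmx Y :=: ratmx N)%MS ->
      (\sum_i row_deg N i <= \sum_i row_deg Y i)%N) ->
  reduced N.
Proof.
move=> fN minN; split=> // y a ya i ai; rewrite leqNgt; apply/negP => lt_y.
pose Y : 'M[P]_(k, m) := \matrix_j (if j == i then y else row j N).
have rY j : row j (ratmx Y) = if j == i then ratmx y else row j (ratmx N).
  by rewrite -ratmx_row rowK; case: eqP => // _; rewrite ratmx_row.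
have NY : (ratmx N <= ratmx Y)%MS.
  apply/row_subP => j; have [->|ji] := eqVneq j i; last first.
    by have := rY j; rewrite (negPf ji) => <-; exact: row_sub.
  have aiE : a 0 i *: row i (ratmx N) =
      row i (ratmx Y) - \sum_(l | l != i) a 0 l *: row l (ratmx Y).
    rewrite rY eqxx ya mulmx_sum_row (bigD1 i) //=.
    rewrite -[LHS]addr0 -addrA; congr (_ + _); apply/esym/eqP; rewrite subr_eq0.
    by apply/eqP/eq_bigr => l li; rewrite rY (negPf li).
  rewrite -(scalerK ai (row i _)) aiE; apply/scalemx_sub/addmx_sub.
    exact: row_sub.
  by rewrite eqmx_opp; apply: summx_sub => l _; apply/scalemx_sub/row_sub.
have fY : row_free (ratmx Y).
  rewrite -row_leq_rank; apply: leq_trans (mxrankS NY).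
  by rewrite row_leq_rank.
have eqYN : (ratmx Y :=: ratmx N)%MS.
  apply/eqmx_sym/eqmxP; rewrite -(geq_leqif (mxrank_leqif_eq NY)).
  by rewrite (eqP fY) (eqP fN).
have := minN Y fY eqYN; rewrite (bigD1 i) //= [in X in (_ <= X)%N](bigD1 i) //=.
rewrite leqNgt => /negP; apply.
rewrite -addSn leq_add //; first by rewrite /row_deg rowK eqxx.
by apply/eq_leq/eq_bigr => l li; rewrite /row_deg rowK (negPf li).
Qed.

Lemma minimal_sum_ex k m (S : 'M[P]_(k, m) -> Prop) N0 : S N0 ->
  exists2 N, S N & forall Y, S Y -> (\sum_i row_deg N i <= \sum_i row_deg Y i)%N.
Proof.
have [n le_n] := ubnP (\sum_i row_deg N0 i)%N.
elim: n => // n IH in N0 le_n *; rewrite ltnS in le_n => SN0.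
have [[Y SY lt_Y]|h] := Classical_Prop.classic
    (exists2 Y, S Y & (\sum_i row_deg Y i < \sum_i row_deg N0 i)%N).
  exact: IH (leq_trans lt_Y le_n) SY.
exists N0 => // Y SY; rewrite leqNgt; apply/negP => lt_Y.
by apply: h; exists Y.
Qed.

Lemma reduced_basis_ex a m (A : 'M[K]_(a, m)) :
  exists2 N : 'M[P]_(\rank A, m), reduced N & (ratmx N :=: A)%MS.
Proof.
have [q [B [q0 qB]]] := common_denominator (row_base A).
have BA : (ratmx B :=: A)%MS.
  by rewrite -qB; apply: eqmx_trans (eqmx_scale _ _) (eq_row_base A); rewrite tofrac_eq0.
pose S (N : 'M[P]_(\rank A, m)) := row_free (ratmx N) /\ (ratmx N :=: A)%MS.
have SB : S B by split=> //; rewrite /row_free BA.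
have [N [fN NA] minN] := minimal_sum_ex SB.
exists N => //; apply: sum_min_reduced => // Y fY YN; apply: minN; split=> //.
exact: eqmx_trans YN NA.
Qed.

Definition col_seq k m (N : 'M[P]_(k, m)) : seq 'cV[P]_m :=
  [seq (row i N)^T | i <- enum 'I_k].

Lemma size_col_seq k m (N : 'M[P]_(k, m)) : size (col_seq N) = k.
Proof. by rewrite size_map size_enum_ord. Qed.

Lemma col_seq_onto k m (X : seq 'cV[P]_m) : size X = k ->
  exists N : 'M[P]_(k, m), col_seq N = X.
Proof.
move=> <-; exists (\matrix_(i < size X) (X`_i)^T).
apply: (@eq_from_nth _ 0); rewrite size_col_seq // => i iX.
rewrite (nth_map (Ordinal iX)) ?size_enum_ord // rowK trmxK.
by rewrite nth_enum_ord.
Qed.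

Lemma vec_degree_tr m (y : 'rV[P]_m) : vec_degree y^T = rdeg y.
Proof. by apply: eq_bigr => j _; rewrite mxE. Qed.

Lemma map_degree_col_seq k m (N : 'M[P]_(k, m)) :
  [seq vec_degree y | y <- col_seq N] = [seq row_deg N i | i <- enum 'I_k].
Proof. by rewrite -map_comp; apply: eq_map => i /=; rewrite vec_degree_tr. Qed.

Lemma sum_degree_col_seq k m (N : 'M[P]_(k, m)) :
  (\sum_(y <- col_seq N) vec_degree y = \sum_i row_deg N i)%N.
Proof.
by rewrite -(big_map (@vec_degree F m) xpredT id) map_degree_col_seq big_map enumT.
Qed.

(** The link between bases as sequences of columns and bases as rows of a matrix. *)
Lemma poly_basisP m n (R : 'M[K]_(m, n)) k (N : 'M[P]_(k, m)) :
  reflect (row_free (ratmx N) /\ (ratmx N :=: kermx R)%MS)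
          (poly_basis (left_null R) (col_seq N)).
Proof.
set X := [seq ratmx y | y <- col_seq N].
have sX : size X == k by rewrite size_map size_col_seq.
have nX (i : 'I_k) : X`_i = (row i (ratmx N))^T.
  have ik : (i < size (enum 'I_k))%N by rewrite size_enum_ord.
  rewrite /X (nth_map 0) ?size_col_seq // (nth_map i) // nth_ord_enum.
  by rewrite -ratmx_row; apply/colP => j; rewrite !mxE.
have combX (c : 'rV[K]_k) : \sum_(i < k) c 0 i *: X`_i = (c *m ratmx N)^T.
  rewrite mulmx_sum_row linear_sum; apply: eq_bigr => i _.
  by rewrite nX linearZ.
have spanX y : (y \in <<X>>%VS) = (y^T <= ratmx N)%MS.
  apply/idP/submxP => [|[c yc]].
    rewrite -[X]/(tval (Tuple sX)) => /coord_span -> /=.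
    exists (\row_i coord (Tuple sX) i y).
    rewrite -[RHS]trmxK -combX; congr trmx; apply: eq_bigr => i _.
    by rewrite mxE.
  rewrite -[y]trmxK yc -combX; apply: memv_suml => i _; apply/memvZ/memv_span.
  by apply: mem_nth; rewrite (eqP sX).
have freeX : free X = row_free (ratmx N).
  apply/idP/idP => [fX|fN].
    apply: inj_row_free => c c0; apply/rowP => i; rewrite mxE.
    apply: (elimT (@freeP _ _ _ (Tuple sX)) fX (fun i => c 0 i)) => /=.
    by rewrite combX c0 trmx0.
  rewrite -[X]/(tval (Tuple sX)); apply/(@freeP _ _ _ (Tuple sX)) => c c0 i.
  have : (\row_i c i) *m ratmx N = 0.
    apply: trmx_inj; rewrite -combX trmx0 -[RHS]c0.
    by apply: eq_bigr => j _; rewrite mxE.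
  rewrite -(mul0mx _ (ratmx N)) => /(row_free_inj fN)/rowP/(_ i).
  by rewrite !mxE.
rewrite /poly_basis /basis_of -/X freeX.
apply: (iffP andP) => [[/eqP sp fN]|[fN eqN]]; split=> //.
  apply/eqmxP/andP; split; apply/rV_subP => y; rewrite -[y]trmxK.
    by rewrite -spanX sp mem_left_null => /eqP h; apply/sub_kermxP.
  by move/sub_kermxP => h; rewrite -spanX sp mem_left_null h.
apply/eqP/vspaceP => y; rewrite spanX eqN mem_left_null.
by apply/sub_kermxP/eqP.
Qed.

(** [row_minimal_indices] without the requirement that the indices are sorted, so
that new indices may be put at the head. *)
Definition null_indices m n (R : 'M[K]_(m, n)) (s : seq nat) : Prop :=
  exists2 X, minimal_basis (left_null R) X & perm_eq s [seq vec_degree y | y <- X].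

Lemma null_indices_perm m n (R : 'M[K]_(m, n)) s s' :
  perm_eq s s' -> null_indices R s -> null_indices R s'.
Proof.
by move=> ss' [X mX Xs]; exists X => //; rewrite (perm_trans _ Xs) // perm_sym.
Qed.

Lemma size_left_null_basis m n (R : 'M[K]_(m, n)) (X Y : seq 'cV[P]_m) :
  poly_basis (left_null R) X -> poly_basis (left_null R) Y -> size X = size Y.
Proof.
move=> /andP[/eqP spX /eqP fX] /andP[/eqP spY /eqP fY].
by move: fX fY; rewrite spX spY !size_map => <-.
Qed.

Lemma null_indices_intro m n (R : 'M[K]_(m, n)) k (N : 'M[P]_(k, m)) s :
    reduced N -> (ratmx N :=: kermx R)%MS ->
    perm_eq s [seq row_deg N i | i <- enum 'I_k] ->
  null_indices R s.
Proof.
move=> rN NR sN; have fN := rN.1.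
have bN : poly_basis (left_null R) (col_seq N) by apply/poly_basisP.
exists (col_seq N); last by rewrite map_degree_col_seq.
split=> // Y bY; have := size_left_null_basis bY bN.
rewrite size_col_seq => /col_seq_onto[M MY]; rewrite -MY in bY *.
have /poly_basisP[fM MR] := bY.
rewrite !sum_degree_col_seq; apply: reduced_sum_min => //.
by rewrite MR NR.
Qed.

Lemma perm_eq_map_ex (T T' : eqType) (f : T -> T') (X : seq T) s :
  perm_eq s (map f X) -> exists2 X', perm_eq X' X & map f X' = s.
Proof.
case: X => [|x0 X] in s *; first by move/perm_nilP=> ->; exists [::].
case/(perm_iotaP (f x0)) => Is pIs sE.
exists (map (nth x0 (x0 :: X)) Is).
  apply/(perm_iotaP x0); exists Is => //.
  by rewrite size_map in pIs.
rewrite sE -map_comp; apply/eq_in_map => i.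
rewrite (perm_mem pIs) mem_iota add0n size_map => /andP[_ iX] /=.
by rewrite -(nth_map x0 (f x0)).
Qed.

(** The rows of the matrix can be numbered in the order in which the indices are
given. *)
Lemma null_indices_elim m n (R : 'M[K]_(m, n)) s : null_indices R s ->
  exists N : 'M[P]_(size s, m), [/\ reduced N, (ratmx N :=: kermx R)%MS &
    forall i, row_deg N i = nth 0%N s i].
Proof.
case=> X [bX minX] /perm_eq_map_ex[X' pX sX].
have sz : size X' = size s by rewrite -sX size_map.
have [N NX] := col_seq_onto sz.
have bX' : poly_basis (left_null R) X'.
  by rewrite /poly_basis (perm_basis _ (perm_map _ pX)).
have := bX'; rewrite -NX => /poly_basisP[fN NR]; exists N; split=> //.
  apply: sum_min_reduced => // Y fY YN; rewrite -!sum_degree_col_seq NX.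
  rewrite (perm_big _ pX) /=; apply: minX; apply/poly_basisP; split=> //.
  exact: eqmx_trans YN NR.
move=> i; have := congr1 (fun t => nth 0%N t i) sX; rewrite /= => <-.
rewrite -NX map_degree_col_seq (nth_map i) ?size_enum_ord //.
by rewrite nth_ord_enum.
Qed.

End Minimality.

(** * Counting polynomial rows of bounded degree *)

Section BoundedRows.

Variable F : fieldType.
Local Notation P := {poly F}.
Local Notation K := (ratfun F).

(** Rows of polynomials of size at most [d j] are identified with coefficient
vectors over F, in order to use ranks over F for dimension counts. *)
Definition row_of_polys p (d : 'I_p -> nat) (a : 'rV[P]_p) :
  'rV[F]_(\sum_j d j) := \mxrow_j (poly_rV (a 0 j) : 'rV[F]_(d j)).

Definition polys_of_row p (d : 'I_p -> nat) (c : 'rV[F]_(\sum_j d j)) :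
  'rV[P]_p := \row_j rVpoly (submxrow c j).

Lemma size_polys_of_row p (d : 'I_p -> nat) (c : 'rV[F]_(\sum_j d j)) j :
  (size (polys_of_row c 0 j)%R <= d j)%N.
Proof. by rewrite mxE size_poly. Qed.

Lemma row_of_polysK p (d : 'I_p -> nat) (a : 'rV[P]_p) :
  (forall j, size (a 0 j)%R <= d j)%N -> polys_of_row (row_of_polys d a) = a.
Proof. by move=> da; apply/rowP => j; rewrite mxE mxrowK poly_rV_K. Qed.

Lemma polys_of_rowK p (d : 'I_p -> nat) (c : 'rV[F]_(\sum_j d j)) :
  row_of_polys d (polys_of_row c) = c.
Proof.
rewrite -[RHS]submxrowK; apply/eq_mxrow => j.
by rewrite mxE rVpolyK.
Qed.

Lemma polys_of_row0 p (d : 'I_p -> nat) :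
  polys_of_row (0 : 'rV[F]_(\sum_j d j)) = 0.
Proof. by apply/rowP => j; rewrite !mxE submxrow0 linear0. Qed.

Definition bounded_mul p e (d : 'I_p -> nat) (d' : 'I_e -> nat) (Q : 'M[P]_(p, e))
  (c : 'rV[F]_(\sum_j d j)) : 'rV[F]_(\sum_j d' j) :=
  row_of_polys d' (polys_of_row c *m Q).

Lemma bounded_mul_is_linear p e (d : 'I_p -> nat) (d' : 'I_e -> nat) Q :
  linear (@bounded_mul p e d d' Q).
Proof.
move=> x u v; rewrite /bounded_mul; have -> : polys_of_row (x *: u + v) =
    x%:P *: polys_of_row u + polys_of_row v.
  apply/rowP => j; rewrite !mxE mul_polyC -linearP; congr rVpoly.
  by apply/rowP => i; rewrite !mxE.
rewrite mulmxDl -scalemxAl.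
apply/rowP => j; rewrite !mxE coefD mul_polyC coefZ.
by [].
Qed.

HB.instance Definition _ p e d d' Q := GRing.isLinear.Build F _ _ _
  (@bounded_mul p e d d' Q) (@bounded_mul_is_linear p e d d' Q).

(** Rank-nullity for multiplication by Q on the rows whose entries have size at
most [a_]: the image has dimension at most the sum of the [b_], the kernel at
most that of the [c_]. *)
Lemma bounded_kernel_count k p e (A : 'M[P]_(k, p)) (Q : 'M[P]_(p, e))
    (a_ : 'I_p -> nat) (b_ : 'I_e -> nat) (c_ : 'I_k -> nat) :
    (forall a : 'rV[P]_p, (forall j, size (a 0 j)%R <= a_ j)%N ->
      forall i, (size ((a *m Q) 0 i)%R <= b_ i)%N) ->
    (forall a : 'rV[P]_p, (forall j, size (a 0 j)%R <= a_ j)%N -> a *m Q = 0 ->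
      exists2 b : 'rV[P]_k, a = b *m A & forall i, (size (b 0 i)%R <= c_ i)%N) ->
  (\sum_j a_ j <= \sum_i b_ i + \sum_i c_ i)%N.
Proof.
move=> sQ kerQ.
pose MQ := lin1_mx (bounded_mul (d := a_) b_ Q).
pose MA := lin1_mx (bounded_mul (d := c_) a_ A).
have kerMQ : (kermx MQ <= MA)%MS.
  apply/rV_subP => u /sub_kermxP; rewrite mul_rV_lin1 => u0.
  have su := size_polys_of_row u.
  have uQ : polys_of_row u *m Q = 0.
    by rewrite -(row_of_polysK (sQ _ su)) [row_of_polys _ _]u0 polys_of_row0.
  have [b ub sb] := kerQ _ su uQ.
  apply/submxP; exists (row_of_polys c_ b).
  by rewrite mul_rV_lin1 /= /bounded_mul row_of_polysK // -ub polys_of_rowK.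
have := mxrankS kerMQ; rewrite mxrank_ker => le_rk.
have := leq_trans le_rk (rank_leq_row MA); have := rank_leq_col MQ.
by lia.
Qed.

(** The central inequality. The row space of N is cut out of that of G by the e
coordinates [f i]. The offset c records that these coordinates may be known to
have degree smaller by c than the vector, in which case they cost fewer linear
conditions; it is zero in the necessity part and is the gap in the
construction of a one-row extension. *)
Lemma degree_sum_le k p m e (N : 'M[P]_(k, m)) (G : 'M[P]_(p, m))
    (f : 'I_e -> 'I_m) c :
    reduced N -> reduced G -> p = (k + e)%N -> (ratmx N <= ratmx G)%MS ->
    (forall y : 'rV[P]_m, (ratmx y <= ratmx G)%MS -> (forall i, y 0 (f i) = 0) ->
      (ratmx y <= ratmx N)%MS) ->
    (forall y : 'rV[P]_m, (ratmx y <= ratmx G)%MS -> forall i, y 0 (f i) != 0 ->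
      (size (y 0 (f i))%R + c <= (rdeg y).+1)%N) ->
  (\sum_i row_deg N i + e * c <= \sum_i row_deg G i)%N.
Proof.
move=> rN rG pE NG kerf degf.
have rowsN i : exists b : 'rV[P]_p, row i N = b *m G.
  have [|b] := @reduced_combination _ _ _ _ (row i N) rG; last by exists b.
  by rewrite ratmx_row; apply: submx_trans (row_sub _ _) NG.
have [A_ AN] := fin_all_exists rowsN.
pose A : 'M[P]_(k, p) := \matrix_i A_ i.
have NA : N = A *m G.
  by apply/row_matrixP => i; rewrite row_mul rowK.
(* Any degree bound that exceeds all the row degrees and c will do. *)
pose D := (\sum_i row_deg N i + \sum_i row_deg G i + c)%N.
have ND i : (row_deg N i <= D)%N.
  by rewrite /D (bigD1 i) //= -!addnA leq_addr.
have GD i : (row_deg G i <= D)%N.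
  by rewrite /D [X in (_ + X + _)%N](bigD1 i) //= addnAC addnCA leq_addr.
have rdeg_comb (a : 'rV[P]_p) : (forall j, size (a 0 j)%R <= D.+1 - row_deg G j)%N ->
    (rdeg (a *m G) <= D)%N.
  move=> sa; apply/rdeg_leP => l; rewrite mxE.
  apply: (leq_trans (size_sum _ _ _)); apply/bigmax_leqP => j _.
  apply: (leq_trans (size_polyMleq _ _)).
  have bound s t x : (s <= D.+1 - x)%N -> (t <= x.+1)%N -> (x <= D)%N ->
    ((s + t).-1 <= D.+1)%N by lia.
  exact: bound (sa j) (size_row_deg G j l) (GD j).
have memG (a : 'rV[P]_p) : (ratmx (a *m G) <= ratmx G)%MS.
  by rewrite ratmxM submxMl.
have : (\sum_j (D.+1 - row_deg G j) <=
    \sum_(i < e) (D.+1 - c) + \sum_i (D.+1 - row_deg N i))%N.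
  apply: (@bounded_kernel_count _ _ _ A (colsub f G)) => a sa.
    move=> i; rewrite mulmx_colsub mxE.
    have [->|y0] := eqVneq ((a *m G) 0 (f i)) 0; first by rewrite size_poly0.
    rewrite leq_subRL ?(leq_trans (leq_addl _ c)) // ?[(c + _)%N]addnC.
      by apply: leq_trans (degf _ (memG a) i y0) _; rewrite ltnS rdeg_comb.
    by rewrite ltnW // ltnS leq_addl.
  rewrite mulmx_colsub => a0.
  have yN : (ratmx (a *m G) <= ratmx N)%MS.
    apply: kerf => // i; move/rowP: a0 => /(_ i).
    by rewrite !mxE.
  have [b ab sb] := reduced_combination rN yN; exists b.
    apply/eqP; rewrite -subr_eq0 -(row_free_mul_eq0 _ rG.1) mulmxBl subr_eq0.
    by rewrite ab NA mulmxA.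
  move=> i; have [->|bi] := eqVneq (b 0 i) 0; first by rewrite size_poly0.
  rewrite leq_subRL ?(leqW (ND i)) // addnC.
  by apply: leq_trans (sb i bi) _; rewrite ltnS rdeg_comb.
have sumB q (h : 'I_q -> nat) : (forall i, h i <= D)%N ->
    (\sum_i (D.+1 - h i) + \sum_i h i = q * D.+1)%N.
  move=> hD; rewrite -big_split /= -[q in RHS]card_ord -sum_nat_const.
  by apply: eq_bigr => i _; rewrite subnK // leqW.
have cD : (c <= D.+1)%N by rewrite leqW // leq_addl.
have := sumB _ _ ND; have := sumB _ _ GD; rewrite sum_nat_const card_ord mulnBr.
have := leq_mul (leqnn e) cD.
have : (p * D.+1 = k * D.+1 + e * D.+1)%N by rewrite pE mulnDl.
by lia.
Qed.

End BoundedRows.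

(** * Adding one row *)

Lemma independent_rows_ex (L : fieldType) a n (A : 'M[L]_(a, n)) x :
  (\rank A + x <= n)%N ->
  exists Q : 'M[L]_(x, n), \rank (col_mx A Q) = (\rank A + x)%N.
Proof.
move=> le_n; have le_x : (x <= \rank A^C)%N by rewrite mxrank_compl; lia.
pose Q : 'M[L]_(x, n) := pid_mx x *m row_base A^C%MS.
have QC : (Q <= A^C)%MS by apply: submx_trans (submxMl _ _) _; rewrite eq_row_base.
exists Q; rewrite -addsmxE mxrank_disjoint_sum; last first.
  by apply/eqP; rewrite -submx0 -(capmx_compl A) capmxS.
by rewrite mxrankMfree ?row_base_free // rank_pid_mx.
Qed.

Section Transfer.

Variable F : fieldType.
Local Notation P := {poly F}.
Local Notation K := (ratfun F).

Lemma row_deg_row_mx0 k m z (N : 'M[P]_(k, m)) i :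
  row_deg (row_mx N (0 : 'M_(k, z))) i = row_deg N i.
Proof. by rewrite /row_deg row_row_mx row0 rdeg_row_mx rdeg0 maxn0. Qed.

Lemma ratmx_row_mx k m z (A : 'M[P]_(k, m)) (B : 'M[P]_(k, z)) :
  ratmx (row_mx A B) = row_mx (ratmx A) (ratmx B).
Proof. exact: map_row_mx. Qed.

Lemma ratmx0 k m : ratmx (0 : 'M[P]_(k, m)) = 0.
Proof. exact: map_mx0. Qed.

Lemma reduced_row_mx0 k m z (N : 'M[P]_(k, m)) :
  reduced N -> reduced (row_mx N (0 : 'M_(k, z))).
Proof.
move=> [fN minN]; split.
  by rewrite /row_free ratmx_row_mx ratmx0 rank_row_mx0.
move=> y a ya i ai; rewrite row_deg_row_mx0.
apply: leq_trans (rdeg_lsubmx y); apply: (minN _ a) => //.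
move: ya; rewrite -{1}[y]hsubmxK !ratmx_row_mx ratmx0 mul_mx_row.
by case/eq_row_mx.
Qed.

Section Rows.

Variables (k m : nat) (N : 'M[P]_(k, m)) (g e : 'I_k -> nat).
Hypothesis degN : forall i, (row_deg N i <= g i + e i)%N.

(** With E_i the sum of the first i of the exponents e, this is the polynomial part
of the sum of the i-th rows divided by X^E_i, computed by a Horner scheme.
Starting from the generator b - iter_quo L, successive multiplication by X^(e i)
and addition of the rows in L never leads to a degree above the bounds g. *)
Fixpoint iter_quo (L : seq 'I_k) : 'rV[P]_m :=
  if L is i :: L' then map_mx (fun f => f %/ 'X^(e i))%R (row i N + iter_quo L')
  else 0.

Definition iter_rem i (L : seq 'I_k) : 'rV[P]_m :=
  map_mx (fun f => f %% 'X^(e i))%R (row i N + iter_quo L).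

(** The rows b_1 := b - iter_quo L and b_{i+1} := X^(e i) b_i + (i-th row of N):
the recursion keeps them in a form where the degree is visible, each one being
a power of X times b plus remainders, of low degree, minus the quotient of the
remaining list. *)
Fixpoint transfer_rows z (b : 'rV[P]_(m + z)) (L : seq 'I_k) : seq 'rV[P]_(m + z) :=
  if L is i :: L' then
    b - row_mx (iter_quo L) 0
      :: transfer_rows ('X^(e i) *: b + row_mx (iter_rem i L') 0) L'
  else [:: b].

Lemma iter_quo_rem i L :
  row i N + iter_quo L = 'X^(e i) *: iter_quo (i :: L) + iter_rem i L.
Proof. by apply/rowP => j; rewrite !mxE mulrC -divp_eq. Qed.

Lemma size_iter_rem i L j : (size (iter_rem i L 0 j)%R <= e i)%N.
Proof.
rewrite mxE -ltnS; have := ltn_modpN0 ((row i N + iter_quo L) 0 j) (q := 'X^(e i)).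
by rewrite size_polyXn; apply; rewrite monic_neq0 ?monicXn.
Qed.

Let decr i j := (g j <= g i)%N.

(** The list is sorted by decreasing g, so the degrees of the later rows, after
their own reduction, do not exceed g of the current one. *)
Lemma size_iter_quo L i0 j :
  path decr i0 L -> (size (iter_quo L 0 j)%R <= (g i0).+1)%N.
Proof.
elim: L i0 => [|i L IH] i0 /=; first by rewrite mxE size_poly0.
case/andP; rewrite /decr => gi /IH le_L; rewrite mxE size_divp; last first.
  by rewrite monic_neq0 ?monicXn.
rewrite size_polyXn /= leq_subLR.
have: (size ((row i N + iter_quo L)%R 0%R j) <= (g i + e i).+1)%N.
  rewrite mxE; apply: leq_trans (size_polyD _ _) _.
  rewrite geq_max mxE (leq_trans (size_row_deg N i j)) ?ltnS //.
  by apply: leq_trans le_L _; rewrite ltnS leq_addr.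
by move=> /leq_trans; apply; move: gi; lia.
Qed.

(** Multiplied by the total power of the variable, [iter_quo L] is a combination of
the rows of N up to the remainders, which have low degree. *)
Lemma iter_quo_expand L : exists (b : 'rV[P]_k) (t : 'rV[P]_m),
  'X^(\sum_(i <- L) e i) *: iter_quo L = b *m N + t /\
  forall j, (size (t 0 j)%R <= \sum_(i <- L) e i)%N.
Proof.
elim: L => [|i L [b [t [IH st]]]].
  by exists 0, 0; rewrite scaler0 mul0mx addr0; split=> // j; rewrite mxE size_poly0.
rewrite big_cons; set E := (\sum_(j <- L) e j)%N in IH st *.
exists ('X^E *: delta_mx 0 i + b), (t - 'X^E *: iter_rem i L); split.
  have /(canRL (addrK _)) := esym (iter_quo_rem i L) => quoE.
  rewrite addnC exprD -scalerA quoE scalerBr scalerDr IH mulmxDl -scalemxAl -rowE.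
  by rewrite !addrA.
move=> j; rewrite mxE [X in (_ + X)%R]mxE [X in (- X)%R]mxE.
apply: leq_trans (size_polyD _ _) _.
rewrite size_polyN geq_max (leq_trans (st j)) ?leq_addl //=.
apply: leq_trans (size_polyMleq _ _) _; rewrite size_polyXn /=.
by rewrite addnC leq_add2r size_iter_rem.
Qed.

Lemma size_transfer_rows z (b : 'rV[P]_(m + z)) L :
  size (transfer_rows b L) = (size L).+1.
Proof. by elim: L b => //= i L IH b; rewrite IH. Qed.

(** Consecutive transfer rows differ, up to a power of the variable, by a row of
N, so they span the rows in L and the generator. *)
Lemma transfer_rows_span z (b : 'rV[P]_(m + z)) L q (S : 'M[K]_(q, m + z)) :
    (forall r, r \in transfer_rows b L -> (ratmx r <= S)%MS) ->
  (ratmx (b - row_mx (iter_quo L) 0) <= S)%MS /\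
  forall i, i \in L -> (ratmx (row_mx (row i N) 0) <= S)%MS.
Proof.
elim: L b => [|i L IH] b /= memS.
  by split=> //; rewrite row_mx0 subr0; apply: memS; rewrite mem_head.
have b1S := memS _ (mem_head _ _).
have [|b2S LS] := IH ('X^(e i) *: b + row_mx (iter_rem i L) 0).
  by move=> r rL; apply: memS; rewrite in_cons rL orbT.
split=> // j; rewrite in_cons => /predU1P[->|/LS//].
have -> : row_mx (row i N) (0 : 'rV_z) =
    ('X^(e i) *: b + row_mx (iter_rem i L) 0 - row_mx (iter_quo L) 0)
    - 'X^(e i) *: (b - row_mx (iter_quo (i :: L)) 0).
  have -> : row i N = 'X^(e i) *: iter_quo (i :: L) + iter_rem i L - iter_quo L.
    by rewrite -iter_quo_rem addrK.
  rewrite scalerBr opprB scale_row_mx scaler0 [RHS]addrC !addrA subrK.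
  by rewrite opp_row_mx !add_row_mx oppr0 !addr0.
rewrite /ratmx map_mxB map_mxZ; apply: addmx_sub => //.
by rewrite eqmx_opp; apply: scalemx_sub.
Qed.

Lemma rdeg_leD z (y w : 'rV[P]_z) D :
  (rdeg y <= D)%N -> (rdeg w <= D)%N -> (rdeg (y + w) <= D)%N.
Proof.
move=> /rdeg_leP yD /rdeg_leP wD; apply/rdeg_leP => j; rewrite mxE.
by apply: leq_trans (size_polyD _ _) _; rewrite geq_max yD wD.
Qed.

Lemma rdegN z (y : 'rV[P]_z) : rdeg (- y) = rdeg y.
Proof. by apply: eq_bigr => j _; rewrite mxE size_polyN. Qed.

Lemma rdeg_scaleX z (y : 'rV[P]_z) n : (rdeg ('X^n *: y) <= n + rdeg y)%N.
Proof.
apply/rdeg_leP => j; rewrite mxE; apply: leq_trans (size_polyMleq _ _) _.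
by rewrite size_polyXn /= -addnS leq_add2l size_row_rdeg.
Qed.

Lemma rdeg_transfer_rows z (b : 'rV[P]_(m + z)) L w0 :
    (rdeg b <= w0)%N -> sorted decr L ->
    (forall i, i \in L -> w0 + \sum_(j <- L) e j <= g i)%N ->
  forall l, (l < (size L).+1)%N -> (rdeg (nth 0%R (transfer_rows b L) l) <=
    nth 0%N (map g L ++ [:: w0 + \sum_(j <- L) e j]) l)%N.
Proof.
elim: L => [|i L IH] in b w0 *; first by move=> bw _ _ [|]; rewrite ?big_nil ?addn0.
move=> bw sL le_g [|l] /=; last first.
  rewrite ltnS big_cons addnA => lL.
  apply: IH => //; last 2 first.
  - exact: path_sorted sL.
  - move=> j jL; have := le_g j; rewrite in_cons jL orbT big_cons addnA; exact.
  apply: rdeg_leD.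
    by apply: leq_trans (rdeg_scaleX _ _) _; rewrite addnC leq_add2r.
  rewrite rdeg_row_mx rdeg0 maxn0; apply/rdeg_leP => j.
  by apply: leq_trans (size_iter_rem _ _ _) _; rewrite leqW ?leq_addl.
move=> _; apply: rdeg_leD.
  apply: leq_trans bw _; apply: leq_trans (le_g i (mem_head _ _)).
  exact: leq_addr.
rewrite rdegN rdeg_row_mx rdeg0 maxn0; apply/rdeg_leP => j.
by apply: (@size_iter_quo (i :: L)); rewrite /= /decr leqnn.
Qed.

End Rows.

(** If the degree of a were too small, the top part of l X^(E + c) p would have to
cancel against rows of N, whose leading coefficients are independent of p, or
against l t, whose degree is too small. The factor X^E serves to make all the
coefficients polynomial. *)
Lemma degree_offset k m (N : 'M[P]_(k, m)) (p : 'rV[F]_m) c (b : 'rV[P]_k)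
    (t a : 'rV[P]_m) (l : P) E :
    reduced N -> row_free (col_mx (coef_rows (row_deg N) N) p) -> (0 < c)%N ->
    (forall j, size (t 0 j)%R <= E)%N -> l != 0 ->
    'X^E *: a + l *: t = b *m N + (l * 'X^(E + c)) *: map_mx polyC p ->
  (size l + c <= (rdeg a).+1)%N.
Proof.
move=> rN fNp c0 tE l0 aE; rewrite leqNgt; apply/negP => lt_a.
pose d (i : 'I_(k + 1)) := match split i with inl i => row_deg N i | inr _ => 0%N end.
pose Np := col_mx N (map_mx polyC p).
pose bl : 'rV[P]_(k + 1) := row_mx b (l * 'X^(E + c))%:M.
have dNp i j : (size (Np i j)%R <= (d i).+1)%N.
  rewrite /Np /d mxE; case: split => i'; first exact: size_row_deg.
  by rewrite mxE size_polyC leq_b1.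
have fNp' : row_free (coef_rows d Np).
  suff -> : coef_rows d Np = col_mx (coef_rows (row_deg N) N) p by [].
  apply/matrixP => i j; rewrite !mxE /d; case: split => i'; rewrite mxE //.
  by rewrite coefC eqxx.
have size_bl j : (size ((bl *m Np) 0 j)%R <= size l + E + c - 1)%N.
  rewrite mul_row_col mul_scalar_mx -aE !mxE; apply: leq_trans (size_polyD _ _) _.
  rewrite geq_max; apply/andP; split; apply: leq_trans (size_polyMleq _ _) _.
    rewrite size_polyXn; have := size_row_rdeg a j.
    have bound s r x : (r.+1 < x + c)%N -> (s <= r.+1)%N ->
      ((E.+1 + s).-1 <= x + E + c - 1)%N by lia.
    exact: bound lt_a.
  have bound s r : (0 < s)%N -> (r <= E)%N -> ((s + r).-1 <= s + E + c - 1)%N.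
    by lia.
  by apply: bound (tE j); rewrite size_poly_gt0.
have lX0 : l * 'X^(E + c) != 0 by rewrite mulf_neq0 // monic_neq0 ?monicXn.
have := predictable_degree dNp fNp' size_bl (i := rshift k ord0).
rewrite row_mxEr mxE eqxx mulr1n => /(_ lX0).
rewrite size_Mmonic ?monicXn // size_polyXn addnS /=.
have contra s q : (0 < s)%N -> ~ (s + (E + c) + q <= s + E + c - 1)%N by lia.
by move/contra; apply; rewrite size_poly_gt0.
Qed.

End Transfer.

Lemma eq_of_leq_sum n (f h : 'I_n -> nat) :
  (forall i, f i <= h i)%N -> (\sum_i h i <= \sum_i f i)%N -> f =1 h.
Proof.
move=> fh; rewrite leqNgt => le_hf i; apply/eqP; rewrite eqn_leq fh /= leqNgt.
apply: contra le_hf => lt_i; rewrite (bigD1 i) //= [X in (_ < X)%N](bigD1 i) //=.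
by rewrite -addSn leq_add // leq_sum.
Qed.

Section Extension.

Variable F : fieldType.
Local Notation P := {poly F}.
Local Notation K := (ratfun F).

(** The implication covers the case c = 0, in which the leading coefficients may
already span the whole space. *)
Lemma lead_complement k m (N : 'M[P]_(k, m)) c :
    reduced N -> c = 0%N \/ (k < m)%N ->
  exists p : 'rV[F]_m, (0 < c)%N -> row_free (col_mx (coef_rows (row_deg N) N) p).
Proof.
move=> rN [->|km]; first by exists 0.
have [|p rk_p] := @independent_rows_ex _ _ _ (coef_rows (row_deg N) N) 1.
  by rewrite (eqP (reduced_lead_free rN)) addn1.
by exists p => _; rewrite /row_free rk_p (eqP (reduced_lead_free rN)).
Qed.

Lemma ratmxD k m (A B : 'M[P]_(k, m)) : ratmx (A + B) = ratmx A + ratmx B.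
Proof. exact: map_mxD. Qed.

Section Step.

Variables (k m n : nat) (R : 'M[K]_(m, n)) (N : 'M[P]_(k, m)).
Variables (g e : 'I_k -> nat) (c : nat).
Hypothesis rN : reduced N.
Hypothesis NR : (ratmx N :=: kermx R)%MS.
Hypothesis degN : forall i, row_deg N i = (g i + e i)%N.
Let w := (c + \sum_i e i)%N.
Hypothesis le_g : forall i, (0 < e i)%N -> (w <= g i)%N.

Let L := sort (fun i j => g j <= g i)%N [seq i <- enum 'I_k | e i != 0%N].
Let L0 := [seq i <- enum 'I_k | e i == 0%N].

Variable p : 'rV[F]_m.
Hypothesis p_free : (0 < c)%N -> row_free (col_mx (coef_rows (row_deg N) N) p).

Let pX : 'rV[P]_m := 'X^c *: map_mx polyC p.
Let y : 'rV[P]_m := iter_quo N e L - pX.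
Let R' : 'M[K]_(m + 1, n) := col_mx R (ratmx y *m R).

Lemma perm_active : perm_eq (L0 ++ L) (enum 'I_k).
Proof.
apply: perm_trans (permEl (perm_filterC (fun i => e i == 0%N) _)).
by rewrite perm_cat2l perm_sort.
Qed.

Lemma sum_active : (\sum_(i <- L) e i = \sum_i e i)%N.
Proof.
rewrite -[RHS]big_enum -(perm_big _ perm_active) big_cat /=.
rewrite [X in (X + _)%N]big1_seq ?add0n // => i /andP[_].
by rewrite mem_filter => /andP[/eqP].
Qed.

Lemma row_extension_rank : \rank (kermx R') = k.+1.
Proof.
have rkR : \rank R' = \rank R.
  by rewrite -addsmxE (addsmx_idPl (submxMl _ _)).
have := rN.1; rewrite /row_free NR !mxrank_ker rkR => /eqP <-.
by rewrite addn1 subSn // rank_leq_row.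
Qed.

Lemma row_extension_null (a : 'rV[K]_m) (l : 'rV[K]_1) :
  (row_mx a l <= kermx R')%MS = ((a + l *m ratmx y)%R <= ratmx N)%MS.
Proof.
by rewrite NR; apply/sub_kermxP/sub_kermxP; rewrite mul_row_col mulmxDl mulmxA.
Qed.

(** The lower bound on the degree sum. By [degree_sum_le] it is enough that the
last coordinate of a vector in the new null space has degree smaller by c than
the vector. *)
Lemma row_extension_degree (Y : 'M[P]_(k.+1, m + 1)) :
    row_free (ratmx Y) -> (ratmx Y :=: kermx R')%MS ->
  (\sum_i (g i + e i) + c <= \sum_i row_deg Y i)%N.
Proof.
move=> fY YR.
have [G rG GR] : exists2 G : 'M[P]_(k.+1, m + 1), reduced G &
    (ratmx G :=: kermx R')%MS.
  by have := reduced_basis_ex (kermx R'); rewrite row_extension_rank.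
apply: leq_trans (reduced_sum_min rG fY _); last by rewrite YR GR.
have sub0 (a : 'rV[K]_m) : (row_mx a (0 : 'rV_1) <= ratmx (row_mx N (0 : 'M_(k, 1))))%MS
    = (a <= ratmx N)%MS.
  rewrite ratmx_row_mx ratmx0; apply/submxP/submxP => -[b].
    by rewrite mul_mx_row mulmx0 => /eq_row_mx[-> _]; exists b.
  by move->; exists b; rewrite mul_mx_row mulmx0.
have -> : (\sum_i (g i + e i) = \sum_i row_deg (row_mx N (0 : 'M_(k, 1))) i)%N.
  by apply: eq_bigr => i _; rewrite row_deg_row_mx0 degN.
have := @degree_sum_le _ k k.+1 (m + 1) 1 (row_mx N 0) G (fun=> rshift m ord0) c
  (reduced_row_mx0 1 rN) rG (esym (addn1 k)).
rewrite mul1n; apply.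
- rewrite GR; apply/rV_subP => v; rewrite -[v]hsubmxK.
  rewrite ratmx_row_mx ratmx0 => /submxP[b]; rewrite mul_mx_row mulmx0.
  case/eq_row_mx => va ->; rewrite row_extension_null mul0mx addr0 va.
  exact: submxMl.
- move=> v; rewrite GR -[v]hsubmxK ratmx_row_mx row_extension_null => vN /(_ ord0).
  rewrite row_mxEr => v0; have l0 : rsubmx v = 0.
    by apply/rowP => j; rewrite ord1 v0 mxE.
  by move: vN; rewrite l0 ratmx0 mul0mx addr0 sub0.
move=> v; rewrite GR -[v]hsubmxK ratmx_row_mx row_extension_null => vN _.
set a := lsubmx v in vN *; set l := rsubmx v in vN *; rewrite row_mxEr => l0.
rewrite rdeg_row_mx; have [c0|c_gt0] := posnP c.
  rewrite c0 addn0; apply: leq_trans (size_row_rdeg l _) _.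
  by rewrite ltnS leq_maxr.
have [|b abN _] := @reduced_combination _ _ _ N (a + l *m y) rN.
  by rewrite ratmxD ratmxM.
have [b' [t [quoE st]]] := iter_quo_expand N e L.
have lE : l *m y = l 0 ord0 *: y by rewrite {1}[l]mx11_scalar mul_scalar_mx.
suff : (size (l 0%R ord0) + c <= (rdeg a).+1)%N.
  by move=> /leq_trans; apply; rewrite ltnS leq_maxl.
apply: (degree_offset (b := 'X^(\sum_(i <- L) e i) *: b - l 0 ord0 *: b')
  rN (p_free c_gt0) c_gt0 st l0).
have -> : a = b *m N - l 0 ord0 *: y by rewrite -lE -abN addrK.
rewrite mulmxBl -!scalemxAl -[b' *m N](addrK t) -quoE exprD.
rewrite scalerBr /y scalerBr !scalerBr /pX !scalerA.
rewrite opprB -!addrA; congr (_ + _).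
rewrite mulrA ![l 0 ord0 * 'X^_]mulrC opprB [RHS]addrC.
by congr (_ + _); rewrite addrC.
Qed.

Let X := [seq row_mx (row i N) (0 : 'rV_1) | i <- L0] ++
  transfer_rows N e (row_mx pX 1%:M) L.
Let bounds := [seq g i | i <- L0] ++ ([seq g i | i <- L] ++ [:: w]).

Lemma size_extension : size X = k.+1.
Proof.
rewrite size_cat size_map size_transfer_rows addnS -size_cat.
by rewrite (perm_size perm_active) size_enum_ord.
Qed.

Lemma perm_bounds : perm_eq bounds (w :: [seq g i | i <- enum 'I_k]).
Proof.
rewrite /bounds catA -map_cat cats1 perm_rcons perm_cons.
exact/perm_map/perm_active.
Qed.

(** The upper bounds on the degrees; together with [row_extension_degree] they show
that the constructed basis is minimal and that the bounds are attained. *)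
Lemma row_extension_bounds i : (i < k.+1)%N -> (rdeg (nth 0%R X i) <= nth 0%N bounds i)%N.
Proof.
move=> ik; rewrite /X /bounds [nth 0%R _ _]nth_cat [nth 0%N _ _]nth_cat !size_map; case: ltnP => iL.
  have [i0] : exists i0 : 'I_k, true by case: L0 iL => // i0; exists i0.
  move=> _; rewrite !(nth_map i0) // rdeg_row_mx rdeg0 maxn0.
  have := mem_nth i0 iL; rewrite mem_filter => /andP[/eqP e0 _].
  by rewrite -[rdeg _]/(row_deg N _) degN e0 addn0.
have degN' l : (row_deg N l <= g l + e l)%N by rewrite degN.
have := @rdeg_transfer_rows _ _ _ N g e degN' 1 (row_mx pX 1%:M) L c.
rewrite sum_active -/w; apply.
- rewrite rdeg_row_mx geq_max; apply/andP; split; last first.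
    by apply/rdeg_leP => j; rewrite mxE ord1 eqxx size_poly1.
  apply: leq_trans (rdeg_scaleX _ _) _; rewrite -[c in X in (_ <= X)%N]addn0.
  rewrite leq_add2l; apply/rdeg_leP => j; rewrite mxE.
  exact: size_polyC_leq1.
- by apply: sort_sorted => i1 i2; apply: leq_total.
- move=> l; rewrite mem_sort mem_filter => /andP[el _].
  by apply: le_g; rewrite lt0n.
rewrite ltn_subLR // addnS -size_cat.
by rewrite (perm_size perm_active) size_enum_ord.
Qed.

Lemma row_extension : exists2 N' : 'M[P]_(k.+1, m + 1),
  reduced N' /\ (ratmx N' :=: kermx R')%MS &
  perm_eq [seq row_deg N' i | i <- enum 'I_k.+1] (w :: [seq g i | i <- enum 'I_k]).
Proof.
pose N' : 'M[P]_(k.+1, m + 1) := \matrix_(i < k.+1) nth 0 X i.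
have rowN' i : row i N' = nth 0 X i by rewrite rowK.
have [] := @transfer_rows_span _ _ _ N e 1 (row_mx pX 1%:M) L _ (ratmx N').
  move=> r rL; have rX : r \in X by rewrite mem_cat rL orbT.
  have ik : (index r X < k.+1)%N by rewrite -size_extension index_mem.
  by rewrite -(nth_index 0 rX) -(rowN' (Ordinal ik)) ratmx_row row_sub.
rewrite opp_row_mx add_row_mx subr0 => yS LS.
have NS i : (ratmx (row_mx (row i N) (0 : 'rV_1)) <= ratmx N')%MS.
  have : i \in L0 ++ L by rewrite (perm_mem perm_active) mem_enum.
  rewrite mem_cat => /orP[iL0|/LS//].
  have rX : row_mx (row i N) 0 \in X.
    rewrite mem_cat; apply/orP; left.
    exact: (map_f (fun i => row_mx (row i N) (0 : 'rV_1)) iL0).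
  have ik : (index (row_mx (row i N) 0) X < k.+1)%N.
    by rewrite -size_extension index_mem.
  by rewrite -(nth_index 0 rX) -(rowN' (Ordinal ik)) ratmx_row row_sub.
have RN' : (kermx R' <= ratmx N')%MS.
  apply/rV_subP => v; rewrite -[v]hsubmxK row_extension_null => /submxP[b ab].
  have -> : row_mx (lsubmx v) (rsubmx v) =
      b *m ratmx (row_mx N 0) + rsubmx v *m ratmx (row_mx (pX - iter_quo N e L) 1%:M).
    have -> : pX - iter_quo N e L = - y by rewrite opprB.
    have -> : ratmx (row_mx (- y) 1%:M) = row_mx (- ratmx y) (1%:M : 'M_1).
      by rewrite ratmx_row_mx /ratmx map_mx1 map_mxN.
    rewrite ratmx_row_mx ratmx0 !mul_mx_row mulmx0 mulmx1 add_row_mx add0r.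
    by rewrite mulmxN -ab addrK.
  apply: addmx_sub; apply: submx_trans (submxMl _ _) _ => //.
  apply/row_subP => i; rewrite -ratmx_row row_row_mx row0; exact: NS.
have N'R : (ratmx N' :=: kermx R')%MS.
  apply/eqmx_sym/eqmxP; rewrite -(geq_leqif (mxrank_leqif_eq RN')).
  by rewrite row_extension_rank rank_leq_row.
have fN' : row_free (ratmx N') by rewrite /row_free N'R row_extension_rank.
have degN' i : (row_deg N' i <= nth 0%N bounds i)%N.
  by rewrite /row_deg rowN'; apply: row_extension_bounds.
have size_bounds : size bounds = k.+1.
  by rewrite (perm_size perm_bounds) /= size_map size_enum_ord.
have sum_bounds : (\sum_(i < k.+1) nth 0%N bounds i = \sum_i (g i + e i) + c)%N.
  rewrite -size_bounds -(big_mkord xpredT (nth 0%N bounds)) -(big_nth 0%N xpredT id).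
  rewrite (perm_big _ perm_bounds) /= big_cons big_map big_enum /= big_split /=.
  by rewrite /w addnC addnA addnAC.
have minN' (Y : 'M[P]_(k.+1, m + 1)) : row_free (ratmx Y) ->
    (ratmx Y :=: ratmx N')%MS -> (\sum_i row_deg N' i <= \sum_i row_deg Y i)%N.
  move=> fY YN'; apply: leq_trans (row_extension_degree fY _); last first.
    exact: eqmx_trans YN' N'R.
  by rewrite -sum_bounds; apply: leq_sum.
exists N'; first by split=> //; apply: sum_min_reduced.
suff -> : [seq row_deg N' i | i <- enum 'I_k.+1] = bounds by exact: perm_bounds.
have le_sum : (\sum_(i < k.+1) nth 0%N bounds i <= \sum_i row_deg N' i)%N.
  by rewrite sum_bounds row_extension_degree.
apply: (@eq_from_nth _ 0%N); rewrite size_map size_enum_ord // => i ik.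
rewrite (nth_map (Ordinal ik)) ?size_enum_ord //.
have -> : nth (Ordinal ik) (enum 'I_k.+1) i = Ordinal ik.
  by apply: val_inj; rewrite /= nth_enum_ord.
exact: eq_of_leq_sum degN' le_sum (Ordinal ik).
Qed.

End Step.

(** The one-row extension: [q.1] are the lowered indices and [q.2] the amounts by
which they were lowered. *)
Lemma null_indices_extension m n (R : 'M[K]_(m, n)) (L : seq (nat * nat)) c :
    null_indices R [seq q.1 + q.2 | q <- L]%N ->
    (forall q, q \in L -> 0 < q.2 -> c + \sum_(r <- L) r.2 <= q.1)%N ->
    c = 0%N \/ (size L < m)%N ->
  exists y : 'rV[P]_m, null_indices (col_mx R (ratmx y *m R))
    ((c + \sum_(r <- L) r.2) :: [seq q.1 | q <- L])%N.
Proof.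
move=> /null_indices_elim; rewrite size_map => -[N [rN NR degN]] le_L cm.
have [p p_free] := lead_complement rN cm.
pose q0 : nat * nat := (0, 0)%N.
pose g (i : 'I_(size L)) := (nth q0 L i).1; pose e (i : 'I_(size L)) := (nth q0 L i).2.
have sum_e : (\sum_i e i = \sum_(r <- L) r.2)%N.
  by rewrite (big_nth q0) big_mkord.
have map_g : [seq g i | i <- enum 'I_(size L)] = [seq q.1 | q <- L].
  apply: (@eq_from_nth _ 0%N) => [|i]; first by rewrite size_map size_enum_ord size_map.
  rewrite size_map size_enum_ord => iL; rewrite (nth_map (Ordinal iL)) ?size_enum_ord // (nth_map q0) // /g.
  by rewrite nth_enum_ord.
have degN' i : row_deg N i = (g i + e i)%N by rewrite degN (nth_map q0).
have le_g i : (0 < e i)%N -> (c + \sum_i e i <= g i)%N.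
  by rewrite sum_e; apply: le_L; rewrite mem_nth.
have [N' [rN' N'R] degs] := row_extension rN NR degN' le_g p_free.
rewrite map_g sum_e in degs.
eexists; apply: (null_indices_intro rN' N'R); rewrite perm_sym; exact: degs.
Qed.

End Extension.

(** * Partial matchings and chains of one-row extensions *)

(** An item is a value v_i together with its partner u_l, if it has one. *)
Definition item := (nat * option nat)%type.
Definition values (l : seq item) : seq nat := [seq x.1 | x <- l].
Definition targets (l : seq item) : seq nat := pmap (fun x => x.2) l.
Definition matched (v t : nat) : item := (v, Some t).

(** Values do not exceed their partners, and every suffix has nonnegative balance
of values against partners: the unmatched values of the suffix can pay for the
lowering of its partners to the matched values. *)
Fixpoint balanced (l : seq item) : bool :=
  if l is x :: l' then
    [&& sumn (targets l) <= sumn (values l),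
        (if x.2 is Some t then x.1 <= t else true) & balanced l']%N
  else true.

Lemma values_cat l1 l2 : values (l1 ++ l2) = values l1 ++ values l2.
Proof. exact: map_cat. Qed.

Lemma targets_cat l1 l2 : targets (l1 ++ l2) = targets l1 ++ targets l2.
Proof. exact: pmap_cat. Qed.

Definition match_all (a : seq (nat * nat)) : seq item :=
  [seq matched x.1 x.2 | x <- a].

Lemma values_match_all a : values (match_all a) = [seq x.1 | x <- a].
Proof. by rewrite /values -map_comp. Qed.

Lemma targets_match_all a : targets (match_all a) = [seq x.2 | x <- a].
Proof. by elim: a => //= x a ->. Qed.

Lemma first_unmatched (l : seq item) : (0 < count (fun x => x.2 == None) l)%N ->
  exists a w b, l = match_all a ++ (w, None) :: b.
Proof.
elim: l => //= -[v [t|]] l IH /= h; last by exists [::], v, l.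
have [a [w [b ->]]] := IH h; by exists ((v, t) :: a), w, b.
Qed.

Lemma all_matched (l : seq item) :
  count (fun x => x.2 == None) l = 0%N -> exists a, l = match_all a.
Proof.
elim: l => [|[v [t|]] l IH] //= h; first by exists [::].
by have [a ->] := IH h; exists ((v, t) :: a).
Qed.

(** In a prefix where all values are matched, balance needs to be checked only at
its beginning, since removing a matched pair does not decrease the balance. *)
Lemma balanced_match_all a s : balanced (match_all a ++ s) =
  [&& all (fun x => x.1 <= x.2)%N a, balanced s &
    (0 < size a)%N ==>
      (sumn (targets (match_all a ++ s)) <= sumn (values (match_all a ++ s)))%N].
Proof.
elim: a => [|[v t] a IH] /=; first by rewrite andbT.
rewrite IH; case: (leqP v t) => vt /=; last by rewrite andbF.
case: (all _ _) => /=; last by rewrite andbF.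
case: (balanced s) => /=; last by rewrite andbF.
case: a {IH} => [|x a] /=; first by rewrite andbT.
by apply: andb_idr; lia.
Qed.

Lemma balanced_all_matched a : balanced (match_all a) ->
  values (match_all a) = targets (match_all a).
Proof.
elim: a => [|[v t] a IH] //= /and3P[le_s vt /IH eq_a].
by rewrite -eq_a in le_s *; congr (_ :: _); lia.
Qed.

(** A total amount d of lowering can be distributed over the pairs without getting
below the values; in a triple (v, (t', e)) of the result, t' is the lowered
partner. *)
Lemma lower_targets (a : seq (nat * nat)) d :
    all (fun x => x.1 <= x.2)%N a ->
    (d + sumn [seq x.1 | x <- a] <= sumn [seq x.2 | x <- a])%N ->
  exists E : seq (nat * (nat * nat)),
    [/\ a = [seq (x.1, x.2.1 + x.2.2)%N | x <- E],
        all (fun x => x.1 <= x.2.1)%N E & sumn [seq x.2.2 | x <- E] = d].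
Proof.
elim: a d => [|[v t] a IH] d /=.
  by move=> _ d0; exists [::]; split=> //=; lia.
case/andP => vt va le_d.
have le_sums : (sumn [seq x.1 | x <- a] <= sumn [seq x.2 | x <- a])%N.
  by elim: (a) va => //= x b IHb /andP[? /IHb]; lia.
have [|E [-> vE sE]] := IH (d - minn d (t - v))%N va; first by lia.
exists ((v, (t - minn d (t - v), minn d (t - v))%N) :: E); split=> /=.
- by congr ((_, _) :: _); lia.
- by rewrite vE andbT; lia.
- by rewrite sE; lia.
Qed.

Section Chain.

Variable F : fieldType.
Local Notation P := {poly F}.
Local Notation K := (ratfun F).

Lemma null_indices_cast m m' n (e : m = m') (R : 'M[K]_(m, n)) s :
  null_indices (castmx (e, erefl n) R) s <-> null_indices R s.
Proof. by case: m' / e; rewrite castmx_id. Qed.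

(** Rows that are independent modulo R have zero coefficients in every relation. *)
Lemma null_indices_independent m n x (R : 'M[K]_(m, n)) (Q : 'M[K]_(x, n)) s :
    \rank (col_mx R Q) = (\rank R + x)%N -> null_indices R s ->
  null_indices (col_mx R Q) s.
Proof.
move=> rkQ /null_indices_elim[N [rN NR degN]].
have NRQ : (ratmx (row_mx N (0 : 'M_(_, x))) <= kermx (col_mx R Q))%MS.
  apply/sub_kermxP; rewrite ratmx_row_mx ratmx0 mul_row_col mul0mx addr0.
  by apply/sub_kermxP; rewrite NR.
apply: (null_indices_intro (reduced_row_mx0 x rN)).
  apply/eqmxP; rewrite -(geq_leqif (mxrank_leqif_eq NRQ)).
  rewrite mxrank_ker rkQ ratmx_row_mx ratmx0 rank_row_mx0 NR mxrank_ker.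
  by rewrite subnDr.
suff <- : s = [seq row_deg (row_mx N (0 : 'M_(_, x))) i | i <- enum 'I_(size s)].
  by [].
apply: (@eq_from_nth _ 0%N) => [|i iL]; first by rewrite size_map size_enum_ord.
rewrite (nth_map (Ordinal iL)) ?size_enum_ord // row_deg_row_mx0 degN.
by rewrite nth_enum_ord.
Qed.

(** Induction on the number of unmatched values; the one-row extension creates the
first unmatched value w, which is the largest one. Let A be the deficit of the
pairs before w, and M the surplus of the items after w. If A > M then the
partners before w are lowered by A - M in total, which produces the index w. If
A <= M then nothing is lowered and the new index w + (M - A) = c is at least w. In
both cases the new index becomes the partner of w, and the total balance of the
new list is zero. *)
Lemma null_indices_chain t m n (R : 'M[K]_(m, n)) l c :
    null_indices R (targets l) ->
    count (fun x => x.2 == None) l = t -> sorted geq (values l) -> balanced l ->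
    sumn (values l) = (sumn (targets l) + c)%N ->
    c = 0%N \/ (size (targets l) < m)%N ->
  exists Y : 'M[P]_(t, m), null_indices (col_mx R (ratmx Y *m R)) (values l).
Proof.
elim: t => [|t IH] in m R l c *.
  move=> nR /all_matched[a lE]; rewrite {}lE in nR * => _ /balanced_all_matched-> _ _.
  exists 0; apply: null_indices_independent => //.
  by rewrite ratmx0 mul0mx [RHS]addn0 -addsmxE (addsmx_idPl (sub0mx _ _)).
move=> nR count_l sl bl sum_l cm.
have [|a [w [b lE]]] := @first_unmatched l; first by rewrite count_l.
have cnt_a (a' : seq (nat * nat)) : count (fun x => x.2 == None) (match_all a') = 0%N.
  by elim: a'.
have count_b : count (fun x => x.2 == None) b = t.
  by move: count_l; rewrite lE count_cat cnt_a /= => -[].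
move: bl sl sum_l nR cm; rewrite lE balanced_match_all /= !values_cat !targets_cat.
rewrite values_match_all targets_match_all /= !sumn_cat /=.
case/andP=> va /andP[/andP[_ bb] _].
move=> sl; have ab : {in a, forall x, (w <= x.1)%N}.
  move: sl; rewrite sorted_pairwise; last by move=> ? ? ? h1 h2; exact: leq_trans h2 h1.
  rewrite pairwise_cat /= => /and3P[/allrelP aw _ _] x xa.
  by apply: aw; rewrite ?mem_head ?map_f.
move=> sum_l nR cm.
have le_b : (sumn (targets b) <= sumn (values b))%N.
  by case: (b) bb => //= x b' /and3P[].
set A := (sumn [seq x.2 | x <- a] - sumn [seq x.1 | x <- a])%N.
set M := (sumn (values b) - sumn (targets b))%N.
have le_a : (sumn [seq x.1 | x <- a] <= sumn [seq x.2 | x <- a])%N.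
  by elim: (a) va => //= x a' IHa /andP[? /IHa]; lia.
have [|E [aE vE sE]] := @lower_targets a (A - M) va; first by rewrite /A; lia.
(* Truncated subtraction covers both cases A > M and A <= M. *)
pose w' := (w + (M - A))%N.
pose L := [seq x.2 | x <- E] ++ [seq (u, 0)%N | u <- targets b].
have sum_L : (\sum_(q <- L) q.2 = A - M)%N.
  rewrite -sE sumnE !big_cat !big_map /=.
  by rewrite [X in (_ + X)%N]big1 ?addn0.
have w'E : (w' = c + \sum_(q <- L) q.2)%N.
  by rewrite sum_L /w' /A /M; lia.
have LT : [seq q.1 + q.2 | q <- L]%N = [seq x.2 | x <- a] ++ targets b.
  rewrite aE map_cat -!map_comp; congr (_ ++ _).
  by rewrite -[RHS]map_id; apply: eq_map => u /=; rewrite addn0.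
have LT1 : [seq q.1 | q <- L] = [seq x.2.1 | x <- E] ++ targets b.
  by rewrite map_cat -!map_comp map_id_in.
have [|q||y] := @null_indices_extension F m n R L c.
- by rewrite LT.
- rewrite -w'E mem_cat => /orP[/mapP[x xE ->]|/mapP[u _ ->]] // x0.
  have : (0 < A - M)%N.
    rewrite -sE; elim: (E) xE => //= z E' IHE; rewrite inE => /predU1P[<-|/IHE]; last by lia.
    by rewrite addn_gt0 x0.
  rewrite /w' subn_gt0 => /ltnW; rewrite -subn_eq0 => /eqP->; rewrite addn0.
  apply: leq_trans (allP vE _ xE); apply: (ab (x.1, x.2.1 + x.2.2)%N).
  by rewrite aE; apply/mapP; exists x.
- by rewrite -LT size_map in cm.
rewrite -w'E LT1 => nR1.
pose E1 := [seq (x.1, x.2.1) | x <- E].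
pose l' := match_all E1 ++ matched w w' :: b.
have valE1 : [seq x.1 | x <- E1] = [seq x.1 | x <- a].
  by rewrite aE -!map_comp.
have values_l' : values l' = [seq x.1 | x <- a] ++ w :: values b.
  by rewrite values_cat values_match_all valE1.
have targets_l' : targets l' = [seq x.2.1 | x <- E] ++ w' :: targets b.
  by rewrite targets_cat targets_match_all -map_comp.
have sumE : (sumn [seq x.2.1 | x <- E] + (A - M) = sumn [seq x.2 | x <- a])%N.
  rewrite -sE aE -map_comp; elim: (E) => //= x E'; rewrite /= => <-; lia.
have sum_l' : sumn (values l') = sumn (targets l').
  rewrite values_l' targets_l' !sumn_cat /= /w'; move: sumE; rewrite /A /M; lia.
have bl' : balanced l'.
  rewrite balanced_match_all -/l' sum_l' leqnn implybT andbT; apply/andP; split.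
    by rewrite /E1 all_map.
  rewrite /= bb andbT; apply/andP; split; last by rewrite /w' leq_addr.
  by rewrite /w' /M; lia.
have [||||||Y' nY'] := IH _ (col_mx R (ratmx y *m R)) l' 0%N.
- apply: null_indices_perm nR1; rewrite targets_l' -cat1s perm_catCA //.
- by rewrite count_cat cnt_a.
- by rewrite values_l'.
- exact: bl'.
- by rewrite sum_l' addn0.
- by left.
rewrite values_l' in nY'.
(* Y' combines the rows of R and the new row y R; expand the latter. *)
pose Y1 : 'M[P]_(1 + t, m) := col_mx y (Y' *m col_mx 1%:M y).
have Y1R : ratmx Y1 *m R = col_mx (ratmx y *m R) (ratmx Y' *m col_mx R (ratmx y *m R)).
  rewrite /ratmx map_col_mx mul_col_mx; congr col_mx.
  by rewrite map_mxM -mulmxA map_col_mx map_mx1 mul_col_mx mul1mx.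
suff : null_indices (col_mx R (ratmx Y1 *m R)) ([seq x.1 | x <- a] ++ w :: values b).
  by exists Y1.
by rewrite Y1R col_mxA; apply/null_indices_cast.
Qed.

End Chain.

(** * Tails of the minimal indices *)

Lemma sorted_geq_nth (u : seq nat) i j : sorted geq u ->
  (i <= j)%N -> (nth 0 u j <= nth 0 u i)%N.
Proof.
move=> su ij; have [ju|ju] := ltnP j (size u); last by rewrite nth_default.
have geq_tr : transitive geq by move=> ? ? ? h1 h2; exact: leq_trans h2 h1.
apply: (sorted_leq_nth geq_tr leqnn 0%N su); rewrite ?inE //.
exact: leq_ltn_trans ju.
Qed.

Lemma sumn_drop (u : seq nat) q :
  sumn (drop q u) = (\sum_(i < size u | q <= i) nth 0 u i)%N.
Proof.
rewrite sumnE (big_nth 0%N) size_drop -(big_mkord (fun i => q <= i)%N (nth 0%N u)).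
under eq_bigr do rewrite nth_drop addnC.
rewrite -(big_addn 0 (size u) q xpredT (nth 0%N u)) add0n.
by rewrite (big_nat_widenl _ 0) // big_mkord.
Qed.

(** A sum over at least as many indices as there are in the tail is at least the
sum of the tail, as the tail consists of the smallest terms. *)
Lemma sumn_drop_le k q q' (u : seq nat) (s : 'I_q' -> 'I_k) :
    size u = k -> sorted geq u -> injective s -> (k - q <= q')%N ->
  (sumn (drop q u) <= \sum_j nth 0 u (s j))%N.
Proof.
move=> uk su inj_s le_q; rewrite sumn_drop uk.
pose S := [set s j | j : 'I_q']; pose T := [set l : 'I_k | (q <= l)%N].
have -> : (\sum_j nth 0 u (s j) = \sum_(l in S) nth 0 u l)%N.
  by rewrite big_imset //= => i j _ _; apply: inj_s.
have -> : (\sum_(i < k | q <= i) nth 0 u i = \sum_(l in T) nth 0 u l)%N.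
  by apply: eq_bigl => l; rewrite inE.
have cardS : #|S| = q' by rewrite card_imset // card_ord.
have cardT : (#|T| <= k - q)%N.
  rewrite -sum1_card (eq_bigl (fun i : 'I_k => q <= i)%N) => [|l]; last by rewrite inE.
  rewrite -(big_mkord (fun i => q <= i)%N (fun=> 1%N)).
  rewrite -(@big_nat_widenl _ _ _ q 0 k xpredT) //.
  by rewrite sum_nat_const_nat muln1.
rewrite (big_setID S) [X in (_ <= X)%N](big_setID T) /= setIC leq_add2l.
apply: (@leq_trans (#|S :\: T| * nth 0 u q)%N).
  apply: (@leq_trans (#|T :\: S| * nth 0 u q)%N).
    rewrite -sum_nat_const; apply: leq_sum => l.
    by rewrite !inE => /andP[_ ql]; apply: sorted_geq_nth.
  rewrite leq_mul2r; apply/orP; right.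
  have := cardsID S T; have := cardsID T S; rewrite setIC; lia.
rewrite -sum_nat_const; apply: leq_sum => l.
by rewrite !inE -ltnNge => /andP[lq _]; apply: sorted_geq_nth => //; exact: ltnW.
Qed.

Section Necessity.

Variable F : fieldType.
Local Notation P := {poly F}.
Local Notation K := (ratfun F).

Lemma ratmx_rowsub k k' m (f : 'I_k' -> 'I_k) (N : 'M[P]_(k, m)) :
  ratmx (rowsub f N) = rowsub f (ratmx N).
Proof. exact: map_mxsub. Qed.

Lemma mul_rowsub1 (L : fieldType) k k' (f : 'I_k' -> 'I_k) (c : 'rV[L]_k') i :
  injective f -> (c *m rowsub f 1%:M) 0 (f i) = c 0 i.
Proof.
move=> inj_f; rewrite mxE (bigD1 i) //= !mxE eqxx mulr1 big1 ?addr0 // => j ji.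
by rewrite !mxE (inj_eq inj_f) (negPf ji) mulr0.
Qed.

Lemma row_free_rowsub (L : fieldType) k k' m (f : 'I_k' -> 'I_k) (A : 'M[L]_(k, m)) :
  injective f -> row_free A -> row_free (rowsub f A).
Proof.
move=> inj_f fA; apply: inj_row_free => c; rewrite rowsubE mulmxA.
rewrite -(mul0mx _ A) => /(row_free_inj fA)/rowP c0; apply/rowP => i.
by rewrite -(mul_rowsub1 c i inj_f) c0 !mxE.
Qed.

Lemma reduced_rowsub k k' m (f : 'I_k' -> 'I_k) (N : 'M[P]_(k, m)) :
  injective f -> reduced N -> reduced (rowsub f N).
Proof.
move=> inj_f [fN minN]; split; first by rewrite ratmx_rowsub row_free_rowsub.
move=> y a; rewrite ratmx_rowsub rowsubE mulmxA => ya i ai.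
rewrite /row_deg row_rowsub -/(row_deg N (f i)); apply: (minN _ _ ya).
by rewrite mul_rowsub1.
Qed.

Lemma tail_ord_proof k h (i : 'I_(k - h)) : (h + i < k)%N.
Proof. by rewrite -ltn_subRL. Qed.

Definition tail_ord k h (i : 'I_(k - h)) : 'I_k := Ordinal (tail_ord_proof i).

Lemma tail_ord_inj k h : injective (@tail_ord k h).
Proof. by move=> i j /(congr1 val)/addnI/val_inj. Qed.

Lemma sum_tail (v : seq nat) h :
  (\sum_(i < size v - h) nth 0 v (tail_ord i) = sumn (drop h v))%N.
Proof.
rewrite sumnE (big_nth 0%N) size_drop big_mkord.
by apply: eq_bigr => i _; rewrite nth_drop.
Qed.

Section TailBounds.

Variables (m n z : nat) (R : 'M[K]_(m, n)) (W : 'M[K]_(z, n)) (u v : seq nat).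
Variables (N : 'M[P]_(size u, m)) (G : 'M[P]_(size v, m + z)) (h q : nat).
Hypotheses (rN : reduced N) (NR : (ratmx N :=: kermx R)%MS)
  (degN : forall i, row_deg N i = nth 0%N u i).
Hypotheses (rG : reduced G) (GRW : (ratmx G :=: kermx (col_mx R W))%MS)
  (degG : forall i, row_deg G i = nth 0%N v i).
Hypothesis gap : forall i l, (i < h)%N -> (q <= l < size u)%N ->
  (nth 0 u l < nth 0 v i)%N.

Let Gh := rowsub (@tail_ord (size v) h) G.
Let B : 'M[K]_(m + z, z) := col_mx 0 1%:M.
Let Uh := (ratmx Gh :&: kermx B)%MS.

Lemma mul_proj_right a (A : 'M[K]_(a, m + z)) : A *m B = rsubmx A.
Proof. by rewrite -{1}[A]hsubmxK mul_row_col mulmx0 mulmx1 add0r. Qed.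

(** By the exchange property a row of degree u_l with l >= q has no component on the
first h rows of the minimal basis of V. *)
Lemma tail_rows_sub :
  (ratmx (row_mx (rowsub (@tail_ord (size u) q) N) (0 : 'M_(_, z))) <= Uh)%MS.
Proof.
rewrite ratmx_row_mx ratmx0 sub_capmx; apply/andP; split; last first.
  by apply/sub_kermxP; rewrite mul_row_col mulmx0 mul0mx addr0.
apply/row_subP => l0; rewrite row_row_mx row0 ratmx_rowsub row_rowsub.
set l := tail_ord l0; pose y : 'rV[P]_(m + z) := row_mx (row l N) 0.
have yE : ratmx y = row_mx (row l (ratmx N)) 0.
  by rewrite ratmx_row_mx ratmx_row ratmx0.
have : (ratmx y <= ratmx G)%MS.
  rewrite GRW; apply/sub_kermxP; rewrite yE mul_row_col mul0mx addr0.
  by apply/sub_kermxP; rewrite -NR row_sub.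
rewrite -yE => /submxP[a ya]; rewrite ya mulmx_sum_row; apply: summx_sub => i _.
have [->|ai] := eqVneq (a 0 i) 0; first by rewrite scale0r sub0mx.
apply: scalemx_sub; have := rG.2 _ _ ya i ai; rewrite degG rdeg_row_mx rdeg0 maxn0.
rewrite -[rdeg _]/(row_deg N l) degN => le_v.
have hi : (h <= i)%N.
  rewrite leqNgt; apply/negP => /(gap (l := l)); rewrite ltn_ord leq_addr /=.
  by move=> /(_ isT); rewrite ltnNge le_v.
have ih : (i - h < size v - h)%N by rewrite ltn_sub2r // (leq_ltn_trans hi).
have -> : row i (ratmx G) = row (Ordinal ih) (ratmx Gh).
  by rewrite ratmx_rowsub row_rowsub; congr row; apply: val_inj; rewrite /= subnKC.
exact: row_sub.
Qed.

Lemma rank_tail_rows : (size u - q <= \rank Uh)%N.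
Proof.
apply: leq_trans (mxrankS tail_rows_sub); rewrite ratmx_row_mx ratmx0 rank_row_mx0.
rewrite row_leq_rank ratmx_rowsub row_free_rowsub ?rN.1 //; exact: tail_ord_inj.
Qed.

Lemma tail_size_le : (size u - q <= size v - h)%N.
Proof.
apply: leq_trans rank_tail_rows _; apply: leq_trans (mxrankS (capmxSl _ _)) _.
exact: rank_leq_row.
Qed.

(** The space [Uh] has at least [size u - q] minimal indices, which are dominated
by distinct indices of U; their sum is at most that of the tail of v by
[degree_sum_le]. *)
Lemma tail_sum_le : sorted geq u -> (sumn (drop q u) <= sumn (drop h v))%N.
Proof.
move=> su; have [H rH HU] := reduced_basis_ex Uh.
have rGh : reduced Gh by apply: reduced_rowsub => //; exact: tail_ord_inj.
pose Z := ratmx Gh *m B.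
have rk : (size v - h = \rank Uh + \rank Z^T)%N.
  by have := mxrank_mul_ker (ratmx Gh) B; rewrite (eqP rGh.1) mxrank_tr addnC.
(* Independent columns of Z suffice to test for a vanishing last part. *)
pose f := maxrankfun Z^T.
have le_deg := @degree_sum_le _ _ _ _ _ H Gh (fun i => rshift m (f i)) 0
  rH rGh rk.
have HG : (ratmx H <= ratmx Gh)%MS by rewrite HU capmxSl.
have {le_deg}le_deg : (\sum_i row_deg H i <= sumn (drop h v))%N.
  rewrite -sum_tail; have -> : (\sum_(i < size v - h) nth 0 v (tail_ord i) =
      \sum_i row_deg Gh i)%N.
    by apply: eq_bigr => i _; rewrite /row_deg row_rowsub [RHS]degG.
  apply: leq_trans (leq_addr (\rank Z^T * 0) _) _.
  apply: le_deg => // y yG; last by move=> i _; rewrite addn0 size_row_rdeg.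
  move=> y0; rewrite HU sub_capmx yG; apply/sub_kermxP.
  have /submxP[a ya] := yG; have /submxP[C ZC] : (Z^T <= rowsub f Z^T)%MS.
    by rewrite eq_maxrowsub.
  apply: trmx_inj; rewrite trmx0 ya -mulmxA -/Z trmx_mul ZC -mulmxA.
  suff -> : rowsub f Z^T *m a^T = 0 by rewrite mulmx0.
  rewrite mul_rowsub_mx -trmx_mul mulmxA -ya mul_proj_right.
  by apply/colP => i; rewrite !mxE y0 tofrac0.
apply: leq_trans le_deg; pose Hl := lsubmx H.
have HB : ratmx H = row_mx (ratmx Hl) 0.
  have HkB : (ratmx H <= kermx B)%MS by rewrite HU capmxSr.
  move/sub_kermxP: HkB; rewrite mul_proj_right => Hr0.
  by rewrite -[LHS]hsubmxK Hr0; congr row_mx; apply/matrixP => i j; rewrite !mxE.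
have fHl : row_free (ratmx Hl).
  by have := rH.1; rewrite HB /row_free rank_row_mx0.
have HlN : (ratmx Hl <= ratmx N)%MS.
  rewrite NR; apply/sub_kermxP; have : (ratmx H <= kermx (col_mx R W))%MS.
    by rewrite -GRW (submx_trans HG) // ratmx_rowsub rowsubE submxMl.
  by move/sub_kermxP; rewrite HB mul_row_col mul0mx addr0.
have [s inj_s sN] := reduced_dominated rN fHl HlN.
apply: leq_trans (sumn_drop_le _ su inj_s rank_tail_rows) _ => //.
apply: leq_sum => j _; rewrite -degN; apply: leq_trans (sN j) _.
have rowHl : row j Hl = lsubmx (row j H) by apply/rowP => l; rewrite !mxE.
by rewrite /row_deg rowHl rdeg_lsubmx.
Qed.

End TailBounds.

End Necessity.

(** * Generalized majorization in terms of tail sums *)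

Lemma nth_zseq u i : (zseq u)`_i = Posz (nth 0%N u i).
Proof.
have [iu|ui] := ltnP i (size u); first by rewrite (nth_map 0%N).
by rewrite !nth_default // size_map.
Qed.

Lemma sum_zseq u : \sum_(e <- zseq u) e = Posz (sumn u).
Proof. by rewrite big_map sumnE (big_morph Posz PoszD erefl). Qed.

Lemma sum_nth_take (u : seq nat) h : (\sum_(0 <= i < h) nth 0 u i = sumn (take h u))%N.
Proof.
elim: h => [|h IH] in u *; first by rewrite big_geq ?take0.
rewrite big_nat_recl //; case: u => [|x u] /=; last by rewrite IH.
by rewrite big1_seq // => i _; rewrite nth_nil.
Qed.

Lemma sum_nth_zseq u h : \sum_(0 <= i < h) (zseq u)`_i = Posz (sumn (take h u)).
Proof.
rewrite -sum_nth_take (big_morph Posz PoszD erefl).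
by apply: eq_bigr => i _; rewrite nth_zseq.
Qed.

Lemma index_gapE v u : index_gap v u = Posz (sumn v) - Posz (sumn u).
Proof. by rewrite /index_gap !sum_zseq. Qed.

Lemma sum_const_psum c l j : (0 < j <= l)%N ->
  \sum_(0 <= i < j) (const_psum c l)`_i = c.
Proof.
case/andP=> j0 jl; rewrite big_ltn // nth_mkseq ?(leq_trans j0) //= big_nat big1 ?addr0 //.
by move=> i /andP[i0 ij]; rewrite nth_mkseq ?(leq_trans ij) //; case: i i0 {ij}.
Qed.

(** The condition of which h_j is the first solution, on natural numbers. *)
Definition overtaken (u v : seq nat) (j i : nat) : bool :=
  (j <= i)%N && ((size u <= i - j) || (nth 0 u (i - j) < nth 0 v i.-1))%N.

Lemma maj_h_overtaken u v j :
  maj_h (zseq u) (zseq v) j = find (overtaken u v j) (iota 0 (size v).+1).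
Proof.
rewrite /maj_h !size_map; apply: eq_find => i.
by rewrite /overtaken !nth_zseq ltz_nat.
Qed.

Lemma maj_hP u v j : (size u + j <= size v)%N ->
  (maj_h (zseq u) (zseq v) j <= size v)%N /\
  overtaken u v j (maj_h (zseq u) (zseq v) j).
Proof.
move=> le_uv; rewrite maj_h_overtaken; set s := iota _ _; set p := overtaken u v j.
have has_p : has p s.
  apply/hasP; exists (size u + j)%N; first by rewrite mem_iota; lia.
  by rewrite /p /overtaken leq_addl addnK leqnn.
have lt_f : (find p s < (size v).+1)%N by rewrite -[X in (_ < X)%N](size_iota 0) -has_find.
by split=> //; have := nth_find 0%N has_p; rewrite nth_iota.
Qed.

Lemma maj_hE u v j h : (h <= size v)%N -> overtaken u v j h ->
  (forall i, (i < h)%N -> ~~ overtaken u v j i) -> maj_h (zseq u) (zseq v) j = h.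
Proof.
move=> hv ph min_h; rewrite maj_h_overtaken.
set s := iota _ _; set p := overtaken u v j in ph min_h *.
have hs : (h < (size v).+1)%N by [].
have has_p : has p s by apply/hasP; exists h; rewrite ?mem_iota.
have lt_f : (find p s < (size v).+1)%N by rewrite -[X in (_ < X)%N](size_iota 0) -has_find.
have := nth_find 0%N has_p; rewrite nth_iota // add0n => pf.
case: (ltngtP (find p s) h) => // [/min_h|lt_h]; first by rewrite pf.
by have := before_find 0%N lt_h; rewrite nth_iota // add0n ph.
Qed.

Lemma gen_majorizedE u v t :
    size v = (size u + t)%N -> (sumn u <= sumn v)%N ->
  gen_majorized (zseq v) (zseq u) (const_psum (index_gap v u) t) <->
  if t is 0 then v = u else
    (forall i, (i < size u)%N -> (nth 0 v (i + t) <= nth 0 u i)%N) /\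
    (forall j, (0 < j <= t)%N ->
      let h := maj_h (zseq u) (zseq v) j in
      (sumn (drop (h - j) u) <= sumn (drop h v))%N).
Proof.
move=> sz le_uv; rewrite /gen_majorized size_mkseq; case: t sz => [|t] sz.
  by split=> [/inj_map|->] //; apply; move=> ? ? [].
have tailE j : (0 < j <= t.+1)%N -> let h := maj_h (zseq u) (zseq v) j in
    (\sum_(0 <= i < h) (zseq v)`_i - \sum_(0 <= i < h - j) (zseq u)`_i <=
      \sum_(0 <= i < j) (const_psum (index_gap v u) t.+1)`_i) =
    (sumn (drop (h - j) u) <= sumn (drop h v))%N.
  move=> jt h; rewrite sum_const_psum // !sum_nth_zseq index_gapE.
  have := congr1 sumn (cat_take_drop h v); rewrite sumn_cat => <-.
  have := congr1 sumn (cat_take_drop (h - j) u); rewrite sumn_cat => <-.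
  by apply/idP/idP; rewrite !PoszD; lia.
have nthE i : ((zseq v)`_(i + t.+1) <= (zseq u)`_i :> int) =
    (nth 0 v (i + t.+1) <= nth 0 u i)%N by rewrite !nth_zseq lez_nat.
split=> [[_ le_nth le_sum _]|[le_nth le_sum]].
  split=> [i iu|j jt /=]; first by rewrite -nthE; apply: le_nth; rewrite size_map.
  by rewrite -tailE //; exact: le_sum.
split.
- by rewrite !size_map.
- by move=> i; rewrite size_map nthE; apply: le_nth.
- by move=> j jt; rewrite tailE //; exact: le_sum.
rewrite (big_nth 0 (r := const_psum _ _)) size_mkseq sum_const_psum ?leqnn //.
by rewrite /index_gap addrC subrK.
Qed.

Lemma size_values l :
  size (values l) = (size (targets l) + count (fun x => x.2 == None) l)%N.
Proof. by elim: l => //= -[v [t|]] l /= ->; rewrite ?addnS. Qed.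

(** Go through v from the left and match the current value with the first unused
u_l if it does not exceed it. The (j+1)-st unmatched position turns out to be
h_(j+1), so that condition (ii) gives the balance after it, and after a matched
value the balance only increases. Condition (i) guarantees that no more than t
values remain unmatched. *)
Lemma matching_ex u v t : sorted geq v -> sorted geq u ->
    size v = (size u + t)%N -> (sumn u <= sumn v)%N ->
    (forall i, (i < size u)%N -> (nth 0 v (i + t) <= nth 0 u i)%N) ->
    (forall j, (0 < j <= t)%N ->
      let h := maj_h (zseq u) (zseq v) j in
      (sumn (drop (h - j) u) <= sumn (drop h v))%N) ->
  exists l, [/\ values l = v, targets l = u & balanced l].
Proof.
move=> sv su sz le_uv le_nth le_sum.
(* q partners and j unmatched values have been used so far. *)
suff build n q j : (size v - (q + j))%N = n -> (q <= size u)%N -> (j <= t)%N ->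
    (forall i, (i < q)%N -> (nth 0 v (i + j) <= nth 0 u i)%N) ->
    (sumn (drop q u) <= sumn (drop (q + j) v))%N ->
  exists l, [/\ values l = drop (q + j) v, targets l = drop q u & balanced l].
  have [] // := build _ 0%N 0%N erefl; first by rewrite !drop0.
  by move=> l; rewrite !drop0; exists l.
elim: n q j => [|n IH] q j def_n qu jt consumed le_tail.
  exists [::]; split=> //; first by rewrite drop_oversize //; lia.
  by rewrite drop_oversize //; lia.
have hv : (q + j < size v)%N by lia.
have [qj|] := boolP ((q < size u) && (nth 0 v (q + j) <= nth 0 u q))%N.
  have /andP[lt_q le_v] := qj.
  move: le_tail; rewrite (drop_nth 0%N hv) (drop_nth 0%N lt_q) /= => le_tail.
  have [||//|i||l [vl tl bl]] := IH q.+1 j; [by lia| by [] | | |].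
  - by rewrite ltnS leq_eqVlt => /predU1P[->//|]; exact: consumed.
  - by rewrite addSn; lia.
  exists (matched (nth 0%N v (q + j)) (nth 0%N u q) :: l).
  by split; rewrite /= ?vl ?tl //; rewrite le_tail le_v bl.
rewrite negb_and -leqNgt -ltnNge => new.
have jt' : (j < t)%N.
  rewrite ltn_neqAle jt andbT; apply/eqP => jE; move: new; rewrite jE.
  case/orP => [uq|]; first by lia.
  have [lt_q|] := ltnP q (size u); last by lia.
  by rewrite ltnNge le_nth.
(* The current position, counted from 1, is the next minimum h_(j+1). *)
have hE : maj_h (zseq u) (zseq v) j.+1 = (q + j.+1)%N.
  apply: maj_hE; first by lia.
    by rewrite /overtaken leq_addl addnK /= addnS.
  move=> i ih; apply/negP => /andP[ji]; have lt_q : (i - j.+1 < q)%N by lia.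
  case/orP => [|]; first by lia.
  rewrite ltnNge (leq_trans _ (consumed _ lt_q)) //.
  by apply: sorted_geq_nth => //; lia.
have [||//|i||l [vl tl bl]] := IH q j.+1; [by lia| by [] | | |].
- by move=> /consumed; apply: leq_trans; apply: sorted_geq_nth => //; lia.
- by have := le_sum j.+1 jt'; rewrite /= hE addnK.
exists ((nth 0%N v (q + j), None) :: l); split=> /=.
- by rewrite vl addnS -drop_nth.
- by [].
- by rewrite vl tl bl andbT addnS; move: le_tail; rewrite (drop_nth 0%N hv).
Qed.

(** * Completion of a matrix *)

Section Completion.

Variable F : fieldType.
Local Notation P := {poly F}.
Local Notation K := (ratfun F).

Lemma majorization_necessary m n z t (R : 'M[K]_(m, n)) (W : 'M[K]_(z, n)) u v :
    sorted geq u -> sorted geq v -> size v = (size u + t)%N ->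
    null_indices R u -> null_indices (col_mx R W) v ->
  0 <= index_gap v u /\
  gen_majorized (zseq v) (zseq u) (const_psum (index_gap v u) t).
Proof.
move=> su sv sz /null_indices_elim[N [rN NR degN]] /null_indices_elim[G [rG GR degG]].
have tail_sum h q := @tail_sum_le F m n z R W u v N G h q rN NR degN rG GR degG.
have tail_size h q := @tail_size_le F m n z R W u v N G h q rN NR degN rG GR degG.
have le_uv : (sumn u <= sumn v)%N by have := tail_sum 0%N 0%N; rewrite !drop0; apply.
split; first by rewrite index_gapE subr_ge0.
have le_nth i : (i < size u)%N -> (nth 0 v (i + t) <= nth 0 u i)%N.
  move=> iu; rewrite leqNgt; apply/negP => lt_uv.
  have gap i' l : (i' < (i + t).+1)%N -> (i <= l < size u)%N ->
      (nth 0 u l < nth 0 v i')%N.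
    rewrite ltnS => i't /andP[il _].
    apply: leq_ltn_trans (sorted_geq_nth su il) (leq_trans lt_uv _).
    exact: sorted_geq_nth.
  have := tail_size _ _ gap; clear -sz iu; lia.
apply/gen_majorizedE => //; case: t => [|t] in sz le_nth *.
  apply/esym/(@eq_from_nth _ 0%N) => [|i iu]; first by rewrite sz addn0.
  have le_nth' j : (nth 0 v j <= nth 0 u j)%N.
    have [ju|uj] := ltnP j (size u); first by have := le_nth j ju; rewrite addn0.
    by rewrite !nth_default // sz addn0.
  have le_sum : (\sum_(j < size u) nth 0 u j <= \sum_(j < size u) nth 0 v j)%N.
    have sv' : size v = size u by rewrite sz addn0.
    rewrite -(big_mkord xpredT (nth 0%N u)) -(big_mkord xpredT (nth 0%N v)).
    rewrite -[X in (_ <= \sum_(0 <= j < X) _)%N]sv'.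
    by rewrite -!(big_nth 0%N xpredT id) -!sumnE.
  exact/esym/(eq_of_leq_sum (fun j => le_nth' j) le_sum (Ordinal iu)).
split=> // j /andP[j0 jt] /=.
have [|hv /andP[jh over]] := @maj_hP u v j; first by rewrite sz leq_add2l.
set h := maj_h _ _ _ in hv jh over *; apply: (tail_sum h (h - j)%N _ su) => i l ih /andP[hl lu].
case/orP: over => [|lt_uv]; first by lia.
apply: leq_ltn_trans (sorted_geq_nth su hl) (leq_trans lt_uv _).
by apply: sorted_geq_nth => //; lia.
Qed.

Lemma majorization_sufficient m n t x (R : 'M[K]_(m, n)) u v :
    sorted geq u -> sorted geq v -> size v = (size u + t)%N ->
    (size u < m)%N -> (\rank R + x <= n)%N ->
    null_indices R u -> 0 <= index_gap v u ->
    gen_majorized (zseq v) (zseq u) (const_psum (index_gap v u) t) ->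
  exists (Y : 'M[P]_(t, m)) (Q : 'M[P]_(x, n)),
    let W := col_mx (ratmx Y *m R) (ratmx Q) in
    \rank (col_mx R W) = (\rank R + x)%N /\ null_indices (col_mx R W) v.
Proof.
move=> su sv sz um rx nR; rewrite index_gapE subr_ge0 lez_nat -index_gapE => le_uv.
move/(gen_majorizedE sz le_uv) => maj.
have [l [vl tl bl]] : exists l, [/\ values l = v, targets l = u & balanced l].
  apply: (matching_ex sv su sz le_uv) => [i iu|j jt /=].
    case: t sz maj => [|t] sz; first by move=> ->; rewrite addn0.
    by case=> le_nth _; apply: le_nth.
  case: t sz maj jt => [|t] sz; first by case: j.
  by case=> _; apply.
have count_l : count (fun x => x.2 == None) l = t.
  by have := size_values l; rewrite vl tl sz => /addnI.
have [||||||Y nY] := @null_indices_chain F t m n R l (sumn v - sumn u).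
- by rewrite tl.
- exact: count_l.
- by rewrite vl.
- exact: bl.
- by rewrite vl tl subnKC.
- by right; rewrite tl.
rewrite vl in nY.
have [Q0 rkQ0] := independent_rows_ex rx.
have [q [Q [q0 qQ]]] := common_denominator Q0.
have eqRY : (col_mx R (ratmx Y *m R) :=: R)%MS.
  exact: eqmx_trans (eqmx_sym (addsmxE _ _)) (addsmx_idPl (submxMl _ _)).
have rkQ : \rank (col_mx (col_mx R (ratmx Y *m R)) (ratmx Q)) =
    (\rank (col_mx R (ratmx Y *m R)) + x)%N.
  rewrite -[LHS]addsmxE -qQ eqRY -rkQ0 -[RHS]addsmxE.
  by rewrite (adds_eqmx eqRY (eqmx_scale Q0 _)) // tofrac_eq0.
exists Y, Q; split; rewrite col_mxA; first by rewrite eqmx_cast rkQ eqRY.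
by apply/null_indices_cast; apply: null_indices_independent nY.
Qed.

End Completion.

Theorem theorem3p15 (F : fieldType) (m n r z x : nat) (u v : seq nat)
    (hr : (1 <= r)%N) (hx : (x <= minn z (n - r))%N)
    (hv : sorted geq v) (sv : size v = (m + z - r - x)%N) :
  (forall R : 'M[ratfun F]_(m, n),
     \rank R = r -> row_minimal_indices R u ->
     ((exists W : 'M[ratfun F]_(z, n),
         \rank (col_mx R W) = (r + x)%N /\
         row_minimal_indices (col_mx R W) v)
      <->
      (0 <= index_gap v u /\
       gen_majorized (zseq v) (zseq u) (const_psum (index_gap v u) (z - x)))))
  /\
  (forall R : 'M[{poly F}]_(m, n),
     \rank (ratmx R) = r -> row_minimal_indices (ratmx R) u ->
     ((exists W : 'M[{poly F}]_(z, n),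
         \rank (ratmx (col_mx R W)) = (r + x)%N /\
         row_minimal_indices (ratmx (col_mx R W)) v)
      <->
      (0 <= index_gap v u /\
       gen_majorized (zseq v) (zseq u) (const_psum (index_gap v u) (z - x))))).
Proof.
have [t zE] : exists t, z = (t + x)%N.
  by exists (z - x)%N; rewrite subnK //; move: hx; rewrite leq_min => /andP[].
subst z; rewrite addnK.
have sizes (R : 'M[ratfun F]_(m, n)) : \rank R = r -> null_indices R u ->
    [/\ size v = (size u + t)%N, (size u < m)%N & (r + x <= n)%N].
  move=> rkR /null_indices_elim[N [[fN _] NR _]].
  have su : size u = (m - r)%N by rewrite -(eqP fN) NR mxrank_ker rkR.
  have := rank_leq_row R; have := rank_leq_col R; rewrite rkR => rn rm.
  by move: hx sv hr; rewrite leq_min su; clear -rn rm; split; lia.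
have necessary (R : 'M[ratfun F]_(m, n)) (W : 'M_(t + x, n)) : \rank R = r ->
    row_minimal_indices R u -> row_minimal_indices (col_mx R W) v ->
    0 <= index_gap v u /\
    gen_majorized (zseq v) (zseq u) (const_psum (index_gap v u) t).
  move=> rkR [su nu] [_ nv]; have [sz _ _] := sizes R rkR nu.
  exact: majorization_necessary nu nv.
have sufficient (R : 'M[ratfun F]_(m, n)) : \rank R = r ->
    row_minimal_indices R u -> 0 <= index_gap v u /\
    gen_majorized (zseq v) (zseq u) (const_psum (index_gap v u) t) ->
  exists (Y : 'M[{poly F}]_(t, m)) (Q : 'M[{poly F}]_(x, n)),
    let W := col_mx (ratmx Y *m R) (ratmx Q) in
    \rank (col_mx R W) = (r + x)%N /\ row_minimal_indices (col_mx R W) v.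
  move=> rkR [su nu] [gap maj]; have [sz um rx] := sizes R rkR nu.
  rewrite -rkR in rx.
  have [Y [Q [rkW nW]]] := majorization_sufficient su hv sz um rx nu gap maj.
  by exists Y, Q; rewrite -rkR.
split=> R rkR nR; split.
- by case=> W [_]; apply: necessary.
- by case/(sufficient R rkR nR) => Y [Q h]; eexists; exact: h.
- by case=> W [_]; rewrite /ratmx map_col_mx; apply: necessary.
case/(sufficient _ rkR nR) => Y [Q h]; exists (col_mx (Y *m R) Q).
by rewrite /ratmx !map_col_mx map_mxM.
Qed.
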